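(* Let $d\in\mathbb{N}$, $-1<q<1$, let $A=(A_1,\dots,A_d)$ be the $q$-Gaussians on $\mathcal{F}_q(H)$, $\dim H=d$, and let $(D_1,\dots,D_d)$ be their normalized dual system given, with domain $\mathcal{F}_{\mathrm{alg}}(H)$, by $D_ie_0=0$ and $$D_ie_{j_n\cdots j_1}=\sum_{\pi\in B(n+1)}(-1)^{\pi(0)-1}q^{\mathrm{cross}(\pi)}\delta_{p(\pi)}e_{s(\pi)}\qquad(n\ge1,\ j_1,\dots,j_n\in[d]).$$ Then the corresponding conjugate system $(\xi_1,\dots,\xi_d)$ of $A$ is given by $$\xi_i=D_i^*e_0=\sum_{w\in[d]^*}(-1)^{|w|}q^{\frac{(|w|+1)|w|}{2}}\,r_{iw}^*e_w,\qquad i\in[d],$$ where $r_{iw}=r_ir_{w_1}\cdots r_{w_n}$ for $w=w_1\cdots w_n$. Moreover, the series for $\xi_i$ converges not only with respect to the Hilbert space norm $\|\cdot\|_q$ but also with respect to the operator norm $\|\cdot\|$, if elements $\eta$ of the Fock space of the form $\eta=Te_0$ with $T\in W^*(A)$ are identified with $T$. Thus $\xi_i=X_ie_0$, where $X_i$ is contained in the norm closure of $\mathbb{C}\langle A\rangle$; in particular $X_i\in W^*(A)$.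
   Context: **$q$-Gaussians.** Let $-1<q<1$, $[d]=\{1,\dots,d\}$, and let $H$ be a $d$-dimensional complex Hilbert space with orthonormal basis $e_1,\dots,e_d$. Let $[d]^*$ be the set of finite words in $[d]$, with empty word denoted $0$ and length $|w|$. The algebraic Fock space is $\mathcal{F}_{\mathrm{alg}}(H)=\bigoplus_{n\ge0}H^{\otimes n}$ (algebraic direct sum), $H^{\otimes0}=\mathbb{C}e_0$, with linear basis $e_w=e_{w_1}\otimes\cdots\otimes e_{w_n}$, $w=w_1\cdots w_n\in[d]^*$. The inner product $\langle\xi,\eta\rangle_q=\langle\xi,\bigoplus_nP^{(n)}\eta\rangle$, with $P^{(n)}e_w=\sum_{\pi\in S_n}q^{|\pi|}e_{w_{\pi(1)}\cdots w_{\pi(n)}}$ for $|w|=n$ and $|\pi|$ the number of inversions, is strictly positive; $\mathcal{F}_q(H)$ is the completion, with norm $\|\cdot\|_q$. The $q$-Gaussians are $A_i=l_i+l_i^*\in B(\mathcal{F}_q(H))$ with $l_i^*e_w=e_{iw}$ and $l_i$ the adjoint of $l_i^*$, given by $l_ie_0=0$, $l_ie_{j_n\cdots j_1}=\sum_{k=1}^nq^{n-k}\delta_{ij_k}e_{j_n\cdots\check{j_k}\cdots j_1}$ ($\check{j_k}$ means omitted). $W^*(A)$ is the von Neumann algebra generated by $A$, $\mathbb{C}\langle A\rangle$ the algebra of noncommutative polynomials in $A$, and $\tau_q(T)=\langle Te_0,e_0\rangle_q$ is a faithful normal trace on $W^*(A)$. The map $T\mapsto Te_0$ identifies $L^2(W^*(A),\tau_q)$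 with $\mathcal{F}_q(H)$ and maps $\mathbb{C}\langle A\rangle$ bijectively onto $\mathcal{F}_{\mathrm{alg}}(H)$; so every $\eta\in\mathcal{F}_{\mathrm{alg}}(H)$ (in particular every $r_{iw}^*e_w\in H^{\otimes(2|w|+1)}$) is identified with a unique operator in $\mathbb{C}\langle A\rangle$, and $\|\eta\|$ denotes its operator norm. **Free right annihilation operators.** $r_i$ is the bounded operator on $\mathcal{F}_q(H)$ determined by $r_ie_0=0$, $r_ie_{wj}=\delta_{ij}e_w$ ($w\in[d]^*$, $j\in[d]$). $r_{iw}^*$ is the adjoint with respect to $\langle\cdot,\cdot\rangle_q$. For $w=0$ the empty word, $r_{iw}=r_i$. **Dual and conjugate systems.** A normalized dual system of $A$ is a tuple of unbounded operators $D_i$ on $\mathcal{F}_q(H)$ with domains containing $\mathcal{F}_{\mathrm{alg}}(H)$, with $D_ie_0=0$, $e_0\in\mathrm{dom}(D_i^* )$ and $[D_i,A_j]=\delta_{ij}P$ on $\mathcal{F}_{\mathrm{alg}}(H)$, $P$ being the orthogonal projection onto $\mathbb{C}e_0$. The free difference quotients $\partial_i:\mathbb{C}\langle x_1,\dots,x_d\rangle\to\mathbb{C}\langle x_1,\dots,x_d\rangle^{\otimes2}$ are determined by the Leibniz rule and $\partial_ix_j=\delta_{ij}1\otimes1$. The conjugate system of $A$ is the unique tuple $(\xi_1,\dots,\xi_d)$ in $\mathcal{F}_q(H)$ with $\langle Q(A)\xi_i,e_0\rangle_q=(\tau_q\otimes\tau_q)[(\partial_iQ)(A)]$ for all $Q\in\mathbb{C}\langle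 x_1,\dots,x_d\rangle$ and $i\in[d]$. For a normalized dual system, the corresponding conjugate system is $\xi_i=D_i^*e_0$. **Combinatorial notation in $D_i$.** For $n\ge1$, $B(n+1)$ is the set of partitions $\pi$ of the vertices $n>n-1>\cdots>1>0$ into pairs and singletons such that: $0$ is paired with some $k=\pi(0)\in\{1,\dots,n\}$; every $l\in\{1,\dots,k-1\}$ is paired with some element of $\{k+1,\dots,n\}$; all remaining vertices are singletons. $p(\pi)$ is the set of pairs, $s(\pi)$ the set of singletons; $\delta_{p(\pi)}=\prod_{(k,l)\in p(\pi)}\delta_{j_kj_l}$ with $j_0:=i$; $e_{s(\pi)}=e_{j_{k_s}\cdots j_{k_1}}$ for $s(\pi)=\{k_s>\cdots>k_1\}$ (and $e_0$ if $s(\pi)=\emptyset$). With $h(x)=l+1$ if $x$ belongs to the pair with smaller element $l$ and $h(x)=\infty$ if $x$ is a singleton, $\mathrm{cross}(\pi)=\sum_{\{l<r\}\in p(\pi)}\#\{x:\ l<x<r,\ h(x)>h(l)\}$ (the number of crossings when a pair with smaller element $l$ is drawn with a horizontal bar at height $l+1$ and singletons are drawn as vertical lines to the top). *)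

(* Defs.v *)
(* The complex numbers are R[i] for an arbitrary R : realType. *)
From HB Require Import structures.
From mathcomp Require Import all_boot all_order all_algebra perm sesquilinear.
From mathcomp Require Import finmap monalg complex.
From mathcomp Require Import boolp classical_sets functions reals topology.
From mathcomp Require Import normedtype summability.

Set Implicit Arguments.
Unset Strict Implicit.
Unset Printing Implicit Defensive.

Import Order.TTheory GRing.Theory Num.Theory.
Import numFieldNormedType.Exports.

Local Open Scope classical_set_scope.
Local Open Scope complex_scope.
Local Open Scope ring_scope.

(* The basis e_w of F_alg(H) is indexed by words in [d] = 'I_d, so that F_alg(H)
   is the free module on words; << w >> is e_w. *)
Definition word (d : nat) := seq 'I_d.

Definition falg (R : realType) (d : nat) := {malg R[i][word d]}.

Section QForm.
Variables (R : realType) (d : nat) (q : R).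

Definition ninv n (s : 'S_n) : nat :=
  #|[pred p : 'I_n * 'I_n | (p.1 < p.2)%N && (s p.2 < s p.1)%N]|.

(* w_{s(1)} ... w_{s(n)} *)
Definition word_perm (w : word d) (s : 'S_(size w)) : word d :=
  [seq tnth (in_tuple w) (s k) | k <- enum 'I_(size w)].

Definition qsym_word (w : word d) : falg R d :=
  \sum_(s : 'S_(size w)) (q%:C ^+ ninv s) *: << word_perm s >>.

(* the operator \bigoplus_n P^(n) *)
Definition qsym (b : falg R d) : falg R d :=
  \sum_(w <- msupp b) b@_w *: qsym_word w.

(* the inner product making (e_w) orthonormal, linear on the left *)
Definition free_form (a b : falg R d) : R[i] :=
  \sum_(w <- msupp a) a@_w * Num.conj (b@_w).

Definition qform (a b : falg R d) : R[i] := free_form a (qsym b).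

End QForm.

(* F_q(H), characterised (up to a unique unitary) as a Hilbert space completion
   of F_alg(H) for the q-inner product. *)
Record qFock (R : realType) (d : nat) (q : R) := QFock {
  fock_space :> completeNormedModType R[i];
  fock_dot : {dot fock_space for (@Num.conj R[i])};
  fock_norm : forall x : fock_space, `|x| ^+ 2 = fock_dot x x;
  fock_emb : {linear falg R d -> fock_space};
  fock_embE : forall a b : falg R d,
    fock_dot (fock_emb a) (fock_emb b) = qform q a b;
  fock_dense : closure (range fock_emb) = [set: fock_space] }.

(* An unbounded operator is defined on the subspace [udom]; the values of
   [ufun] outside of [udom] are irrelevant. *)
Record unbounded_op (K : pzRingType) (V : lmodType K) := UnboundedOp {
  udom : set V;
  ufun :> V -> V;
  udom0 : udom 0;
  udom_linear : forall (a : K) (x y : V),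
    udom x -> udom y -> udom (a *: x + y);
  ufun_linear : forall (a : K) (x y : V),
    udom x -> udom y -> ufun (a *: x + y) = a *: ufun x + ufun y }.

Section FreeDifferenceQuotient.
Variables (R : realType) (d : nat).

(* C<x_1, ..., x_d> has the words (monomials) as a linear basis, and its tensor
   square the pairs of words. *)
Definition ncpoly := {malg R[i][word d]}.
Definition ncpoly2 := {malg R[i][(word d * word d)%type]}.

(* Leibniz rule: d_i (x_j m) = delta_ij 1 (x) m + (x_j (x) 1) (d_i m);
   the list enumerates the summands u (x) v of d_i m. *)
Fixpoint fdq_word (i : 'I_d) (w : word d) : seq (word d * word d)%type :=
  if w is j :: m then
    (if i == j then [:: ([::], m)] else [::])
      ++ [seq (j :: p.1, p.2) | p <- fdq_word i m]
  else [::].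

Definition fdq (i : 'I_d) (Q : ncpoly) : ncpoly2 :=
  \sum_(w <- msupp Q) Q@_w *: \sum_(p <- fdq_word i w) << p >>.

End FreeDifferenceQuotient.

Section Operators.
Variables (R : realType) (d : nat) (q : R) (F : qFock d q).

Local Notation dot := (fock_dot F).

Definition ebasis (w : word d) : F := fock_emb F << w >>.
Local Notation e0 := (ebasis [::]).

Definition fock_alg : set F := range (fock_emb F).

Definition bounded_op (T : F -> F) : Prop :=
  linear T /\ exists M : R, forall x, `|T x| <= M%:C * `|x|.

(* S = T^* *)
Definition is_adjoint (T S : F -> F) : Prop :=
  forall x y, dot (T x) y = dot x (S y).

(* Norms take values in R[i]; [complex.Re] only changes the type. *)
Definition opnorm (T : F -> F) : R :=
  sup [set complex.Re `|T x| | x in [set x : F | `|x| <= 1]].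

Definition opword (A : 'I_d -> F -> F) (w : word d) : F -> F :=
  foldr (fun j T => A j \o T) idfun w.

Definition opeval (A : 'I_d -> F -> F) (Q : ncpoly R d) : F -> F :=
  \sum_(w <- msupp Q) Q@_w *: opword A w.

(* C<A> *)
Definition poly_alg (A : 'I_d -> F -> F) : set (F -> F) := range (opeval A).

Definition norm_closure (M : set (F -> F)) : set (F -> F) :=
  [set T | bounded_op T /\
    forall eps : R, 0 < eps -> exists2 S, M S & opnorm (T - S) < eps].

Definition commutant (M : set (F -> F)) : set (F -> F) :=
  [set T | bounded_op T /\ forall S, M S -> T \o S = S \o T].

Definition von_neumann_algebra (M : set (F -> F)) : Prop :=
  (forall T S, M T -> is_adjoint T S -> M S) /\ commutant (commutant M) = M.

(* W^*(A) *)
Definition vn_generated (A : 'I_d -> F -> F) : set (F -> F) :=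
  [set T | forall M, von_neumann_algebra M -> (forall i, M (A i)) -> M T].

Definition tau (T : F -> F) : R[i] := dot (T e0) e0.

(* (tau (x) tau)[P(A)] *)
Definition tau2_eval (A : 'I_d -> F -> F) (P : ncpoly2 R d) : R[i] :=
  \sum_(p <- msupp P) P@_p * (tau (opword A p.1) * tau (opword A p.2)).

Definition left_creation (ls : 'I_d -> F -> F) : Prop :=
  forall i, bounded_op (ls i) /\ forall w, ls i (ebasis w) = ebasis (i :: w).

Definition qgaussian (l ls : 'I_d -> F -> F) (i : 'I_d) : F -> F := l i + ls i.

Definition free_right_annihilation (r : 'I_d -> F -> F) : Prop :=
  forall i, [/\ bounded_op (r i), r i e0 = 0 &
    forall w j, r i (ebasis (rcons w j)) = (i == j)%:R *: ebasis w].

(* y belongs to dom(D^* ) and D^* y = z *)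
Definition adjoint_at (D : unbounded_op F) (y z : F) : Prop :=
  forall x, udom D x -> dot (D x) y = dot x z.

Definition normalized_dual_system (A : 'I_d -> F -> F)
    (D : 'I_d -> unbounded_op F) : Prop :=
  forall i, [/\ fock_alg `<=` udom (D i), D i e0 = 0,
    exists z, adjoint_at (D i) e0 z &
    forall j x, fock_alg x ->
      D i (A j x) - A j (D i x) = (i == j)%:R *: (dot x e0 *: e0)].

Definition conjugate_system (A : 'I_d -> F -> F) (xi : 'I_d -> F) : Prop :=
  forall (i : 'I_d) (Q : ncpoly R d),
    dot (opeval A Q (xi i)) e0 = tau2_eval A (fdq i Q).

End Operators.

Arguments ebasis {R d q} F w.
Arguments fock_alg {R d q} F.

Section Pairings.
Variable n : nat.
Implicit Types f : {ffun 'I_n.+1 -> 'I_n.+1}.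

(* A partition of {0, ..., n} into pairs and singletons is encoded by the
   involution f exchanging the elements of each pair and fixing the singletons;
   f ord0 is thus pi(0). *)
Definition inB f : bool :=
  [&& [forall v, f (f v) == v],
      f ord0 != ord0,
      [forall l : 'I_n.+1, (0 < l < f ord0)%N ==> (f ord0 < f l)%N] &
      [forall v : 'I_n.+1, (f ord0 < v)%N && (f v != v) ==> (f v < f ord0)%N]].

(* Heights of pairs are at most n + 1, so n + 2 stands for infinity. *)
Definition height f (x : 'I_n.+1) : nat :=
  if f x == x then n.+2 else (minn x (f x)).+1.

Definition cross f : nat :=
  \sum_(l : 'I_n.+1 | (l < f l)%N)
    #|[pred x : 'I_n.+1 | (l < x < f l)%N && (height f l < height f x)%N]|.

End Pairings.

Section DualFormula.
Variables (R : realType) (d : nat) (q : R) (F : qFock d q).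
Variables (i : 'I_d) (w : word d).

(* With w = j_n ... j_1, vertex k carries the letter j_k, where j_0 = i. *)
Definition letter (k : 'I_(size w).+1) : 'I_d := nth i (i :: rev w) k.

Definition delta_pairs (f : {ffun 'I_(size w).+1 -> 'I_(size w).+1}) : R[i] :=
  \prod_(l : 'I_(size w).+1 | (l < f l)%N) (letter (f l) == letter l)%:R.

(* [enum] lists vertices increasingly, words are read from the largest one *)
Definition word_singletons (f : {ffun 'I_(size w).+1 -> 'I_(size w).+1})
  : word d := [seq letter k | k <- rev (enum [pred k | f k == k])].

Definition dual_formula : F :=
  \sum_(f : {ffun 'I_(size w).+1 -> 'I_(size w).+1} | inB f)
    ((-1) ^+ (f ord0).-1 * q%:C ^+ cross f * delta_pairs f)
      *: ebasis F (word_singletons f).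

End DualFormula.

Arguments dual_formula {R d q} F i w.

(* (-1)^|w| q^(|w|(|w|+1)/2) *)
Definition xi_coef (R : realType) (d : nat) (q : R) (w : word d) : R[i] :=
  (-1) ^+ size w * q%:C ^+ ((size w).+1 * size w)./2.

(* Main.v *)
(* Every r_u with |u| = N sends a word of length N to a multiple of the vacuum,
   so it reads off one coefficient of a vector of H^(x)N.  Hence r_iw^* e_w,
   which lies in H^(x)(2m+1) for |w| = m, has coefficients growing at most
   exponentially in m.  The Wick recursion W_ju = A_j W_u - sum_k q^k W_(u minus
   its k-th letter) [u_k = j] likewise gives |W_u| <= K^|u|.  So the operator attached to
   r_iw^* e_w has norm at most exponential in m, and the factor q^(m(m+1)/2)
   beats both this and the number d^m of words: the series converges absolutely
   in operator norm.
   A partition in B(n+1) contributes to <D_i e_v, e_0> only if it has no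
   singleton; then n = 2m+1, the partition is a permutation t of {0, ..., m} with
   t 0 = 0, and it has m(m+1)/2 + inv(t) crossings.  The resulting sum is the
   q-inner product of the two halves of v, which is also what r_iw^* produces. *)
Require Import Defs.
From HB Require Import structures.
From mathcomp Require Import all_boot all_order all_algebra perm sesquilinear.
From mathcomp Require Import finmap monalg complex.
From mathcomp Require Import boolp classical_sets functions reals topology.
From mathcomp Require Import normedtype summability sequences.
From mathcomp Require Import zify ring lra.

Set Implicit Arguments.
Unset Strict Implicit.
Unset Printing Implicit Defensive.

Import Order.TTheory GRing.Theory Num.Theory.
Import numFieldNormedType.Exports.

Local Open Scope classical_set_scope.
Local Open Scope ring_scope.

#[local] Existing Instance totally_filter.

(** * Inversions and sums over permutations *)

Section Inversions.

Lemma sum_ltn_ord (N k : nat) : (k <= N)%N -> (\sum_(i < N) (i < k) = k)%N.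
Proof.
move=> kN; transitivity (\sum_(i < N | (i < k)%N) 1)%N.
  by rewrite [RHS]big_mkcond /=; apply: eq_bigr => i _; case: ifP.
by rewrite -(big_ord_widen N (fun=> 1%N)) // sum1_card card_ord.
Qed.

Lemma ninvE (n : nat) (s : 'S_n) :
  ninv s = (\sum_(i < n) \sum_(j < n) ((i < j) && (s j < s i)))%N.
Proof.
rewrite /ninv -sum1_card big_mkcond /=.
rewrite pair_big /=; apply: eq_bigr => -[i j] _ /=.
by case: ifP; rewrite inE /= => ->.
Qed.

Lemma sum_lift_lt (n : nat) (k : 'I_n.+1) :
  (\sum_(i < n) (lift k i < k))%N = k.
Proof.
have -> : (\sum_(i < n) (lift k i < k) = \sum_(i < n) (i < k))%N.
  by apply: eq_bigr => i _; rewrite /= /bump; congr (nat_of_bool _); lia.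
rewrite -[RHS](sum_ltn_ord (ltnW (ltn_ord k))) big_ord_recr /=.
rewrite [X in (_ + X)%N](_ : _ = 0%N) ?addn0 //.
by have := ltn_ord k; lia.
Qed.

(** Position 0, sent to [k], forms an inversion with each of the [k] smaller values; [lift] is
    increasing, so the remaining inversions are those of [s]. *)
Lemma ninv_lift_perm (n : nat) (k : 'I_n.+1) (s : 'S_n) :
  ninv (lift_perm ord0 k s) = (k + ninv s)%N.
Proof.
rewrite !ninvE big_ord_recl big_ord_recl /= add0n; congr (_ + _)%N.
  rewrite -[RHS]sum_lift_lt [RHS](reindex_inj (@perm_inj _ s)) /=.
  by apply: eq_bigr => i _; rewrite lift_perm_id lift_perm_lift.
apply: eq_bigr => i _; rewrite big_ord_recl /= add0n.
apply: eq_bigr => j _; rewrite !lift_perm_lift /= /bump.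
by congr (nat_of_bool _); lia.
Qed.

Lemma ninvV (n : nat) (s : 'S_n) : ninv s^-1%g = ninv s.
Proof.
rewrite !ninvE (reindex_inj (@perm_inj _ s)) exchange_big /=.
rewrite (reindex_inj (@perm_inj _ s)) /=.
apply: eq_bigr => i _; apply: eq_bigr => j _.
by rewrite !permK andbC.
Qed.

Definition rev_perm (n : nat) : 'S_n := perm (@rev_ord_inj n).

(** Conjugation by the reversal flips the order of positions and of values, so inverted pairs
    correspond to inverted pairs. *)
Lemma ninv_rev (n : nat) (s : 'S_n) :
  ninv (rev_perm n * s * rev_perm n)%g = ninv s.
Proof.
rewrite !ninvE (reindex_inj (@rev_ord_inj n)) exchange_big /=.
rewrite (reindex_inj (@rev_ord_inj n)) /=.
apply: eq_bigr => i _; apply: eq_bigr => j _.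
rewrite !permM !permE /= !rev_ordK.
have := (ltn_ord i, ltn_ord j, ltn_ord (s i), ltn_ord (s j)).
by move=> [[[? ?] ?] ?]; congr (nat_of_bool (_ && _)); lia.
Qed.

Lemma big_perm_recl (V : nmodType) (n : nat) (F : 'S_n.+1 -> V) :
  \sum_(t : 'S_n.+1) F t = \sum_(k < n.+1) \sum_(s : 'S_n) F (lift_perm ord0 k s).
Proof.
rewrite (partition_big (fun t : 'S_n.+1 => t ord0) xpredT) //=.
apply: eq_bigr => k _.
(* [ulsf i s] deletes the position [i] and the value [s i] from [s]; for [i = ord0] this undoes
   [lift_perm]. *)
pose ulsf (i : 'I_n.+1) (s : 'S_n.+1) j := odflt j (unlift (s i) (s (lift i j))).
have ulsfK i (s : 'S_n.+1) j : lift (s i) (ulsf i s j) = s (lift i j).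
  rewrite /ulsf; have:= neq_lift i j.
  by rewrite -(can_eq (permK s)) => /unlift_some[] ? ? ->.
have inj_ulsf : injective (ulsf ord0 _).
  move=> s; apply: can_inj (ulsf (s ord0) s^-1%g) _ => k'.
  by rewrite {1}/ulsf ulsfK !permK liftK.
rewrite (reindex (lift_perm ord0 k)) /=.
  by apply: eq_bigl => s; rewrite lift_perm_id eqxx.
exists (fun s => perm (inj_ulsf s)) => [s _ | s].
  by apply/permP=> k'; rewrite permE /ulsf lift_perm_lift lift_perm_id liftK.
move/(_ =P _) => si0; apply/permP=> k'.
case: (unliftP ord0 k') => [k''|] ->; rewrite ?lift_perm_id //.
by rewrite lift_perm_lift -si0 permE ulsfK.
Qed.

End Inversions.

Section PermSum.
Variables (K : comNzRingType) (T : eqType) (q : K).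

(* The q-inner product of the words a 0 ... a (n-1) and b 0 ... b (n-1). *)
Definition permsum (n : nat) (a b : nat -> T) : K :=
  \sum_(s : 'S_n) q ^+ ninv s * \prod_(k < n) (a k == b (s k))%:R.

(** Sorting permutations by the image [k] of 0 gives the combinatorial form of the annihilation
    formula: delete the [k]-th letter at cost [q ^+ k]. *)
Lemma permsum_recl (n : nat) (a b : nat -> T) :
  permsum n.+1 a b = \sum_(k < n.+1)
    q ^+ k * (a 0%N == b k)%:R * permsum n (a \o succn) (b \o bump k).
Proof.
rewrite /permsum big_perm_recl; apply: eq_bigr => k _.
rewrite mulr_sumr; apply: eq_bigr => s _.
rewrite ninv_lift_perm exprD big_ord_recl lift_perm_id /= -!mulrA; congr (_ * _).
rewrite mulrCA; congr (_ * (_ * _)); apply: eq_bigr => i _.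
by rewrite lift_perm_lift.
Qed.

Lemma permsumC (n : nat) (a b : nat -> T) : permsum n a b = permsum n b a.
Proof.
rewrite /permsum (reindex_inj (@invg_inj 'S_n)) /=; apply: eq_bigr => s _.
rewrite ninvV (reindex_inj (@perm_inj _ s)) /=; congr (_ * _).
by apply: eq_bigr => i _; rewrite permK eq_sym.
Qed.

(** Needed because the dual formula numbers letters from the right end of a word, whereas the inner
    product reads words from the left. *)
Lemma permsum_rev (n : nat) (a b : nat -> T) :
  permsum n (fun k => a (n - k.+1)%N) (fun k => b (n - k.+1)%N) = permsum n a b.
Proof.
have rK : involutive (fun s : 'S_n => rev_perm n * s * rev_perm n)%g.
  move=> s /=; apply/permP => i; rewrite !permM !permE /=.
  by rewrite !rev_ordK.
rewrite /permsum (reindex_inj (inv_inj rK)) /=; apply: eq_bigr => s _.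
rewrite ninv_rev (reindex_inj (@rev_ord_inj n)) /=; congr (_ * _).
apply: eq_bigr => i _; rewrite !permM !permE !rev_ordK /=.
have h (x : 'I_n) : (n - (n - x.+1).+1 = x)%N by have := ltn_ord x; lia.
by rewrite !h.
Qed.

Lemma eq_permsum (n : nat) (a a' b b' : nat -> T) :
    (forall k, (k < n)%N -> a k = a' k) -> (forall k, (k < n)%N -> b k = b' k) ->
  permsum n a b = permsum n a' b'.
Proof.
move=> ea eb; apply: eq_bigr => s _; congr (_ * _); apply: eq_bigr => k _.
by rewrite ea // eb.
Qed.

End PermSum.

(** * Partitions without singletons *)

Section Pairing.
Variable m : nat.

(* On {0, ..., 2m+1}, t matches the lower half {0, ..., m} with the upper half:
   l is paired with m + 1 + t l. *)
Definition pairing (t : 'S_m.+1) :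
    {ffun 'I_(m + m.+1).+1 -> 'I_(m + m.+1).+1} :=
  [ffun x : 'I_(m.+1 + m.+1) => match fintype.split x with
    | inl l => rshift m.+1 (t l)
    | inr r => lshift m.+1 (t^-1%g r) end].

Lemma pairingL (t : 'S_m.+1) (l : 'I_m.+1) :
  pairing t (lshift m.+1 l) = rshift m.+1 (t l).
Proof. by rewrite ffunE (unsplitK (inl l)). Qed.

Lemma pairingR (t : 'S_m.+1) (r : 'I_m.+1) :
  pairing t (rshift m.+1 r) = lshift m.+1 (t^-1%g r).
Proof. by rewrite ffunE (unsplitK (inr r)). Qed.

Lemma pairing0 (t : 'S_m.+1) : pairing t ord0 = rshift m.+1 (t ord0).
Proof. by rewrite -pairingL; congr (pairing t _); apply: val_inj. Qed.

Lemma pairing_inj : injective pairing.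
Proof.
move=> t u tu; apply/permP => l.
by apply: (@rshift_inj m.+1); rewrite -!pairingL tu.
Qed.

Lemma pairingK (t : 'S_m.+1) : involutive (pairing t).
Proof.
move=> x; case: (split_ordP (x : 'I_(m.+1 + m.+1))) => [l | r] ->.
  by rewrite pairingL pairingR permK.
by rewrite pairingR pairingL permKV.
Qed.

Lemma pairing_fix (t : 'S_m.+1) x : pairing t x != x.
Proof.
case: (split_ordP (x : 'I_(m.+1 + m.+1))) => [l | r] ->.
  by rewrite pairingL -val_eqE /=; have := ltn_ord l; lia.
by rewrite pairingR -val_eqE /=; have := ltn_ord (t^-1%g r); lia.
Qed.

(** Fixing 0 pairs vertex 0 with m + 1, so the vertices below the partner of 0 are exactly the lower
    half, all matched into the upper half. *)
Lemma inB_pairing (t : 'S_m.+1) : t ord0 = ord0 -> inB (pairing t).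
Proof.
move=> t0.
have f0 : pairing t ord0 = m.+1 :> nat by rewrite pairing0 t0 /= addn0.
apply/and4P; split; first by apply/forallP => x; rewrite pairingK.
- exact: pairing_fix.
- apply/forallP => x; apply/implyP; rewrite f0.
  case: (split_ordP (x : 'I_(m.+1 + m.+1))) => [l | r] ->; last by move=> /=; lia.
  rewrite pairingL /= => /andP[l0 _].
  suff : t l != ord0 by rewrite -val_eqE /=; lia.
  rewrite -t0 (inj_eq perm_inj); apply: contraTneq l0 => -> //.
- apply/forallP => x; apply/implyP; rewrite f0.
  case: (split_ordP (x : 'I_(m.+1 + m.+1))) => [l | r] ->.
    by have := ltn_ord l; move=> /=; lia.
  by rewrite pairingR /= => _; apply: ltn_ord.
Qed.

(** Since the partner of 0 is m + 1, membership in B sends each of 1, ..., m above m + 1;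
    injectivity of [f] turns this map of halves into a permutation. *)
Lemma pairingP (f : {ffun 'I_(m + m.+1).+1 -> 'I_(m + m.+1).+1}) :
    inB f -> f ord0 = m.+1 :> nat ->
  exists2 t : 'S_m.+1, t ord0 = ord0 & f = pairing t.
Proof.
move=> /and4P[/forallP fK _ /forallP fL _] f0.
have fI : injective f by move=> x y xy; rewrite -(eqP (fK x)) xy (eqP (fK y)).
(* The value [ord0] in the first branch is a dummy: [fg] shows that [f] never maps the lower half
   into itself. *)
pose g (l : 'I_m.+1) : 'I_m.+1 :=
  match fintype.split (f (@lshift m.+1 m.+1 l) : 'I_(m.+1 + m.+1)) with
  | inl _ => ord0 | inr r => r end.
have fg l : f (@lshift m.+1 m.+1 l) = @rshift m.+1 m.+1 (g l).
  rewrite /g; case: (split_ordP (f _ : 'I_(m.+1 + m.+1))) => [k fk|r -> //].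
  have [l0|l0] := posnP l.
    have e : @lshift m.+1 m.+1 l = ord0 :> 'I_(m + m.+1).+1 by apply: val_inj.
    by have := ltn_ord k; have := congr1 val fk; rewrite e /= f0; lia.
  have := implyP (fL (@lshift m.+1 m.+1 l)); rewrite f0 fk /= l0 ltn_ord.
  by move=> /(_ isT); have := ltn_ord k; lia.
have gI : injective g.
  by move=> x y xy; apply: (@lshift_inj m.+1 m.+1); apply: fI; rewrite !fg xy.
exists (perm gI).
  rewrite permE; apply: (@rshift_inj m.+1); rewrite -fg; apply: val_inj => /=.
  apply: etrans _ (esym (addn0 _)); apply: etrans _ f0.
  congr (nat_of_ord (f _)); exact: val_inj.
apply/ffunP => x; case: (split_ordP (x : 'I_(m.+1 + m.+1))) => [l | r] ->.
  by rewrite pairingL permE fg.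
rewrite pairingR -{1}(permKV (perm gI) r) permE -fg; exact/eqP/fK.
Qed.

(** The bar starting at [l] is crossed by the line of every lower vertex [x] > [l], which gives
    m(m+1)/2 in total, and by the line of an upper vertex m + 1 + t x exactly when [l] < [x] and t x
    < t l, which gives the inversions. *)
Lemma cross_pairing (t : 'S_m.+1) :
  cross (pairing t) = ((m.+1 * m)./2 + ninv t)%N.
Proof.
have -> : cross (pairing t) = (\sum_(l : 'I_(m.+1 + m.+1))
   \sum_(x : 'I_(m.+1 + m.+1)) [&& l < pairing t l, l < x < pairing t l &
      l < minn x (pairing t x)])%N.
  rewrite /cross big_mkcond /=; apply: eq_bigr => l _.
  case: ifP => lf; last by rewrite big1.
  rewrite -sum1_card big_mkcond /=; apply: eq_bigr => x _.
  rewrite inE /height !(negbTE (pairing_fix _ _)).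
  by have -> : minn l (pairing t l) = l by lia.
rewrite big_split_ord /= [X in (_ + X)%N]big1 ?addn0; last first.
  move=> l _; rewrite big1 // => x _; rewrite pairingR /=.
  by have := ltn_ord (t^-1%g l); lia.
have -> : (m.+1 * m)./2 = (\sum_(l < m.+1) \sum_(x < m.+1) (l < x))%N.
  rewrite exchange_big /=.
  under eq_bigr do rewrite sum_ltn_ord ?(ltnW (ltn_ord _)) //.
  by rewrite -(big_mkord xpredT id) bin2_sum bin2.
rewrite ninvE -big_split /=; apply: eq_bigr => l _.
rewrite big_split_ord /=; congr (_ + _)%N.
  apply: eq_bigr => x _; rewrite !pairingL /=.
  by have := ltn_ord l; have := ltn_ord x; lia.
rewrite (reindex_inj (@perm_inj _ t)) /=; apply: eq_bigr => x _.
rewrite !pairingL !pairingR permK /=.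
by have := ltn_ord l; have := ltn_ord x; lia.
Qed.

End Pairing.

(** With k the partner of 0, [f] exchanges the vertices strictly between 0 and k with those above k.
    Equating the two counts gives k - 1 = n - k. *)
Lemma inB_size (n : nat) (f : {ffun 'I_n.+1 -> 'I_n.+1}) :
  inB f -> (forall v, f v != v) -> n = ((f ord0).-1 + (f ord0).-1.+1)%N.
Proof.
move=> /and4P[/forallP fK f00 /forallP fL /forallP fR] fF.
set k := f ord0.
have k0 : (0 < k)%N by move: f00; rewrite -val_eqE /= /k; lia.
have fI : injective f by move=> x y xy; rewrite -(eqP (fK x)) xy (eqP (fK y)).
have e x : ((0 < f x < k) = (k < x))%N.
  have := implyP (fL (f x)); have := implyP (fR x).
  rewrite (eqP (fK x)) fF andbT -/k => h1 h2.
  have [kx|] := boolP (k < x)%N; last by move=> kx; apply/negP => /h2; lia.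
  rewrite h1 // andbT lt0n; apply: contraTneq kx => fx.
  suff -> : x = k by rewrite ltnn.
  by apply: fI; rewrite (eqP (fK _)); apply: val_inj.
have h1 : (\sum_(x < n.+1) (0 < x < k) = \sum_(x < n.+1) (k < x))%N.
  by rewrite (reindex_inj fI) /=; apply: eq_bigr => x _; rewrite e.
have h2 : (\sum_(x < n.+1) (0 < x < k) + \sum_(x < n.+1) (x < 1)
    = \sum_(x < n.+1) (x < k))%N.
  by rewrite -big_split; apply: eq_bigr => x _ /=; lia.
have h3 : (\sum_(x < n.+1) (k < x) + \sum_(x < n.+1) (x < k.+1)
    = \sum_(x < n.+1) (x < n.+1))%N.
  by rewrite -big_split; apply: eq_bigr => x _ /=; have := ltn_ord x; lia.
rewrite !sum_ltn_ord ?(ltnW (ltn_ord _)) // in h2 h3.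
have kn := ltn_ord k.
lia.
Qed.

(** * The vacuum component of the dual formula *)

Section DualSum.
Variables (K : comNzRingType) (T : eqType) (q : K) (a : nat -> T).

(** The coefficient in [dual_formula], with the letters given by a function on naturals so that the
    word does not enter the type. *)
Definition dual_term (n : nat) (f : {ffun 'I_n.+1 -> 'I_n.+1}) : K :=
  (-1) ^+ (f ord0).-1 * q ^+ cross f
    * \prod_(l : 'I_n.+1 | (l < f l)%N) (a (f l) == a l)%:R.

Lemma sum_dual_term (m : nat) : 
  \sum_(f : {ffun 'I_(m + m.+1).+1 -> 'I_(m + m.+1).+1} |
        inB f && [forall v, f v != v]) dual_term f
  = (-1) ^+ m * q ^+ (m.+1 * m)./2 * (a m.+1 == a 0)%:R
    * permsum q m (fun k => a k.+1) (fun k => a (m.+2 + k)%N).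
Proof.
pose B := ([set pairing t | t in [set t : 'S_m.+1 | t ord0 == ord0]])%SET.
rewrite (eq_bigl (fun f => f \in B)); last first.
  move=> f; apply/idP/imsetP => [/andP[fB /forallP fF] | [t]].
    have [||t t0 ->] := @pairingP m f => //; last by exists t; rewrite // inE t0.
    by have := inB_size fB fF; move: fB => /and4P[_ + _ _]; rewrite -val_eqE /=; lia.
  rewrite inE => /eqP t0 ->; rewrite inB_pairing //=.
  by apply/forallP => v; apply: pairing_fix.
rewrite big_imset /=; last by move=> t u _ _; apply: pairing_inj.
under eq_bigl do rewrite inE.
(* Permutations fixing 0 are the [lift_perm ord0 ord0 s]; this leaves a sum over permutations [s] of
   m elements. *)
rewrite big_mkcond big_perm_recl big_ord_recl /= [X in _ + X]big1 ?addr0; last first.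
  by move=> k _; apply: big1 => s _; rewrite lift_perm_id.
rewrite mulr_sumr; apply: eq_bigr => s _; rewrite lift_perm_id eqxx.
rewrite /dual_term pairing0 lift_perm_id /= addn0 cross_pairing ninv_lift_perm.
rewrite /= add0n exprD.
set P := (X in _ * X = _).
have -> : P = (a m.+1 == a 0)%:R *
    \prod_(k < m) (a k.+1 == a (m.+2 + s k)%N)%:R.
  rewrite /P (@big_split_ord _ _ _ m.+1 m.+1) /= mulrC big_pred0; last first.
    move=> r; rewrite pairingR; move: (fun_of_perm _ r) => l /=; have := ltn_ord l; lia.
  rewrite mul1r (eq_bigl xpredT); last first.
    by move=> l; rewrite pairingL /=; have := ltn_ord l; lia.
  rewrite big_ord_recl pairingL lift_perm_id /= addn0; congr (_ * _).
  apply: eq_bigr => k _; rewrite pairingL lift_perm_lift /= eq_sym.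
  by rewrite /bump /= !add1n addnS.
by rewrite !mulrA -!(mulrAC _ _ (a m.+1 == a 0)%:R).
Qed.

End DualSum.

(** * The q-inner product of words *)

Section Gram.
Variables (R : realType) (d : nat) (q : R).
Local Open Scope complex_scope.

Lemma conj_realC (x : R) : Num.conj x%:C = x%:C.
Proof. by apply: conj_Creal; apply/complex_realP; exists x. Qed.

Lemma norm_realC (x : R) : `|x%:C| = `|x|%:C.
Proof. by rewrite normc_def /= expr0n addr0 sqrtr_sqr. Qed.

Lemma malgUZ (K : choiceType) (S : nzRingType) (c : S) (k : K) :
  << c *g k >> = c *: << k >> :> {malg S[K]}.
Proof. by apply/malgP => j; rewrite mcoeffZ !mcoeffU mulrnAr mulr1. Qed.

Lemma qform_basis (u v : word d) : qform q << u >> << v >> =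
  \sum_(s : 'S_(size v)) q%:C ^+ ninv s * (word_perm s == u)%:R :> R[i].
Proof.
rewrite /qform /free_form msuppU oner_eq0 big_seq_fset1 mcoeffU eqxx mul1r.
rewrite /qsym msuppU oner_eq0 big_seq_fset1 mcoeffU eqxx scale1r /qsym_word.
rewrite !raddf_sum /=; apply: eq_bigr => s _.
by rewrite mcoeffZ mcoeffU rmorphM rmorphXn rmorph_nat /= conj_realC.
Qed.

Lemma size_word_perm (v : word d) (s : 'S_(size v)) : size (word_perm s) = size v.
Proof. by rewrite size_map size_enum_ord. Qed.

Lemma qform_size (u v : word d) : size u != size v -> qform q << u >> << v >> = 0.
Proof.
move=> uv; rewrite qform_basis big1 // => s _.
case: eqP => [e|]; last by rewrite mulr0.
by move: uv; rewrite -e size_word_perm eqxx.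
Qed.

Lemma qform_permsum (x0 : 'I_d) (u v : word d) : size u = size v ->
  qform q << u >> << v >> = permsum q%:C (size v) (nth x0 u) (nth x0 v).
Proof.
move=> uv; rewrite qform_basis; apply: eq_bigr => s _; congr (_ * _).
have e k : nth x0 (word_perm s) (k : 'I_(size v)) = nth x0 v (s k).
  by rewrite (nth_map k) ?size_enum_ord // nth_ord_enum (tnth_nth x0).
case: eqP => [<-|ne].
  by rewrite big1 // => k _; rewrite e eqxx.
apply/esym/eqP; rewrite prodf_seq_eq0; apply/hasP.
have [k h|h] := pickP (fun k : 'I_(size v) => nth x0 u k != nth x0 v (s k)).
  by exists k; rewrite ?mem_index_enum //= (negbTE h).
case: ne; apply: (@eq_from_nth _ x0); first by rewrite size_word_perm.
move=> k; rewrite size_word_perm => kv.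
by have /negbFE/eqP -> := h (Ordinal kv); rewrite (e (Ordinal kv)).
Qed.

Definition del (v : word d) (k : nat) : word d := take k v ++ drop k.+1 v.

Lemma size_del (v : word d) (k : nat) : (k < size v)%N -> size (del v k) = (size v).-1.
Proof. by move=> kv; rewrite size_cat size_take size_drop kv; lia. Qed.

Lemma nth_del (x0 : 'I_d) (v : word d) (k i : nat) :
  (k < size v)%N -> nth x0 (del v k) i = nth x0 v (bump k i).
Proof.
move=> kv; rewrite nth_cat size_take kv /bump.
case: ltnP => ik; first by rewrite nth_take.
by rewrite nth_drop; congr (nth _ _ _); lia.
Qed.

(** The first letter of the left word is matched with some letter of [v]. By adjointness this
    identity determines [l] on basis vectors. *)
Lemma qform_cons (j : 'I_d) (u v : word d) : qform q << j :: u >> << v >> =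
  \sum_(k < size v) q%:C ^+ k * (j == tnth (in_tuple v) k)%:R
    * qform q << u >> << del v k >>.
Proof.
have [e|ne] := eqVneq (size u).+1 (size v); last first.
  rewrite qform_size // big1 // => k _; rewrite qform_size ?mulr0 // size_del //.
  by have := ltn_ord k; lia.
rewrite (@qform_permsum j) //.
case: v e => // x v [e] /=; rewrite permsum_recl; apply: eq_bigr => k _.
rewrite /= (tnth_nth j); congr (_ * _).
have sd : size (del (x :: v) k) = size v by rewrite size_del.
rewrite (@qform_permsum j) ?sd //; apply: eq_permsum => // i _.
by rewrite nth_del.
Qed.

End Gram.

(** * Hilbert space geometry of the q-Fock space *)

Section FockBasics.
Variables (R : realType) (d : nat) (q : R) (F : qFock d q).
Local Open Scope complex_scope.
Local Notation dot := (fock_dot F).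
Local Notation e_ := (ebasis F).

Lemma dotC (x y : F) : dot x y = Num.conj (dot y x).
Proof. by rewrite hermC expr0 mul1r. Qed.

Lemma dotDl (x y z : F) : dot (x + y) z = dot x z + dot y z.
Proof. exact: linearDl. Qed.
Lemma dotDr (x y z : F) : dot z (x + y) = dot z x + dot z y.
Proof. exact: linearDr. Qed.
Lemma dotBl (x y z : F) : dot (x - y) z = dot x z - dot y z.
Proof. exact: linearBl. Qed.
Lemma dotBr (x y z : F) : dot z (x - y) = dot z x - dot z y.
Proof. exact: linearBr. Qed.
Lemma dotZl (a : R[i]) (x z : F) : dot (a *: x) z = a * dot x z.
Proof. exact: linearZl_LR. Qed.
Lemma dotZr (a : R[i]) (x z : F) : dot z (a *: x) = Num.conj a * dot z x.
Proof. exact: linearZr_LR. Qed.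
Lemma dot_suml (I : Type) (s : seq I) (P : pred I) (f : I -> F) (z : F) :
  dot (\sum_(i <- s | P i) f i) z = \sum_(i <- s | P i) dot (f i) z.
Proof. exact: linear_sumlz. Qed.
Lemma dot_sumr (I : Type) (s : seq I) (P : pred I) (f : I -> F) (z : F) :
  dot z (\sum_(i <- s | P i) f i) = \sum_(i <- s | P i) dot z (f i).
Proof. exact: linear_sumr. Qed.

Lemma dot_eq0 (x : F) : dot x x = 0 -> x = 0.
Proof. by move=> x0; apply/eqP; rewrite -normr_eq0 -sqrf_eq0 fock_norm x0. Qed.

Lemma cauchy_schwarz (x y : F) : `|dot x y| <= `|x| * `|y|.
Proof.
(* In the application [p] and [r] are the squared norms of [u] and [y], where x = u + a y with [u]
   orthogonal to [y]; the claim is then Pythagoras. *)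
have aux (C : numDomainType) (b p r : C) : 0 <= p -> 0 <= r ->
    `|b * r| ^+ 2 <= (p + `|b| ^+ 2 * r) * r.
  move=> p0 r0; rewrite normrM exprMn (ger0_norm r0) mulrDl -(mulrA _ r r) -expr2 lerDr.
  exact: mulr_ge0.
have [->|y0] := eqVneq y 0; first by rewrite normr0 mulr0 linear0r normr0.
have yy : dot y y != 0 by apply: contra_neq y0; apply: dot_eq0.
pose a := dot x y / dot y y; pose u := x - a *: y.
have uy : dot u y = 0 by rewrite dotBl dotZl divfK ?subrr.
rewrite -(@ler_pXn2r _ 2) // ?nnegrE ?mulr_ge0 // exprMn !fock_norm.
have ex : x = u + a *: y by rewrite subrK.
have -> : dot x y = a * dot y y by rewrite divfK.
move: (a) (u) uy ex => {u}a {}u uy ex.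
have -> : dot x x = dot u u + `|a| ^+ 2 * dot y y.
  rewrite ex dotDl !dotDr !dotZl !dotZr uy (dotC y u) uy rmorph0 !mulr0 addr0 add0r.
  by rewrite mulrA normCK.
have dot_ge0 z : 0 <= dot z z by rewrite -fock_norm exprn_ge0.
exact: aux.
Qed.

Lemma fock_embS (a : falg R d) : fock_emb F a = \sum_(w <- msupp a) a@_w *: e_ w.
Proof.
rewrite {1}(monalgE a) linear_sum; apply: eq_bigr => w _.
by rewrite malgUZ linearZ_LR.
Qed.

Lemma dot_basis (u v : word d) : dot (e_ u) (e_ v) = qform q << u >> << v >>.
Proof. exact: fock_embE. Qed.

Lemma dot_basis_size (u v : word d) : size u != size v -> dot (e_ u) (e_ v) = 0.
Proof. by rewrite dot_basis; apply: qform_size. Qed.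

Lemma dot_vacuum : dot (e_ [::]) (e_ [::]) = 1.
Proof.
rewrite dot_basis qform_basis (eq_bigr (fun=> 1)) ?sumr_const ?card_Sn ?mulr1n //.
move=> s _; rewrite ninvE big_ord0 expr0 mul1r.
by rewrite (size0nil (size_word_perm s)).
Qed.

Lemma norm_vacuum : `|e_ [::]| = 1.
Proof.
by apply/eqP; rewrite -(@eqrXn2 _ 2) // fock_norm dot_vacuum expr1n.
Qed.

(** The difference z is orthogonal to a dense subspace. If z were nonzero, an approximant closer
    than |z| would give |z|^2 <= |z - a| |z| < |z|^2. *)
Lemma dot_ext (x y : F) : (forall v, dot (e_ v) x = dot (e_ v) y) -> x = y.
Proof.
move=> xy; apply/eqP; rewrite -subr_eq0; apply/eqP; set z := x - y.
have zv a : dot (fock_emb F a) z = 0.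
  rewrite fock_embS dot_suml big1 // => v _.
  by rewrite dotZl dotBr xy subrr mulr0.
have [//|] := eqVneq z 0; rewrite -normr_gt0 => z0; exfalso.
have : closure (range (fock_emb F)) z by rewrite fock_dense.
move=> /(_ _ (nbhsx_ballx z `|z| z0)) [_ [[a _ <-]]].
rewrite -ball_normE /= => za.
have : `|z| ^+ 2 <= `|z - fock_emb F a| * `|z|.
  rewrite -[leLHS]ger0_norm ?exprn_ge0 // fock_norm.
  by rewrite -{1}(subrK (fock_emb F a) z) dotDl zv addr0 cauchy_schwarz.
by rewrite expr2 ler_pM2r // => /le_lt_trans /(_ za); rewrite ltxx.
Qed.

End FockBasics.

(** * Operators with explicit norm bounds *)

Section LinearFun.
Variables (K : pzRingType) (U V : lmodType K) (f : U -> V).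
Hypothesis f_lin : linear f.

Lemma lin0 : f 0 = 0.
Proof. by have := f_lin (-1) 0 0; rewrite scaler0 addr0 scaleN1r addNr. Qed.

Lemma linD (x y : U) : f (x + y) = f x + f y.
Proof. by have := f_lin 1 x y; rewrite !scale1r. Qed.

Lemma linZ (a : K) (x : U) : f (a *: x) = a *: f x.
Proof. by have := f_lin a x 0; rewrite !addr0 lin0 addr0. Qed.

Lemma linB (x y : U) : f (x - y) = f x - f y.
Proof. by rewrite linD -scaleN1r linZ scaleN1r. Qed.

Lemma lin_sum (I : Type) (s : seq I) (P : pred I) (g : I -> U) :
  f (\sum_(i <- s | P i) g i) = \sum_(i <- s | P i) f (g i).
Proof. exact: (big_morph f linD lin0). Qed.

End LinearFun.

(** The index set of the sum depends on [Q]; over one finite set containing all supports involved,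
    linearity is termwise. *)
Lemma malg_eval_linear (K : choiceType) (T : nzRingType) (V : lmodType T)
    (h : K -> V) :
  linear (fun Q : {malg T[K]} => \sum_(k <- msupp Q) Q@_k *: h k).
Proof.
have ext (Q : {malg T[K]}) (D : {fset K}) : (msupp Q `<=` D)%fset ->
    \sum_(k <- msupp Q) Q@_k *: h k = \sum_(k <- D) Q@_k *: h k.
  move=> QD; rewrite (big_fset_incl _ QD) // => k _ /mcoeff_outdom ->.
  by rewrite scale0r.
move=> a P Q; pose D := (msupp P `|` msupp Q `|` msupp (a *: P + Q))%fset.
have dP : (msupp P `<=` D)%fset by rewrite /D -fsetUA fsubsetUl.
have dQ : (msupp Q `<=` D)%fset by rewrite /D fsetUAC fsubsetUr.
have dR : (msupp (a *: P + Q) `<=` D)%fset by rewrite /D fsubsetUr.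
rewrite (ext _ _ dP) (ext _ _ dQ) (ext _ _ dR) scaler_sumr -big_split /=.
by apply: eq_bigr => w _; rewrite mcoeffD mcoeffZ scalerDl scalerA.
Qed.

Section Operators.
Variables (R : realType) (d : nat) (q : R) (F : qFock d q).
Local Open Scope complex_scope.
Local Notation dot := (fock_dot F).
Local Notation e_ := (ebasis F).

(** Linearity together with a named real bound, so that explicit constants can be carried through
    sums, compositions and adjoints. *)
Definition op_le (T : F -> F) (M : R) : Prop :=
  linear T /\ forall x, `|T x| <= M%:C * `|x|.

Lemma op_le_bounded (T : F -> F) (M : R) : op_le T M -> bounded_op T.
Proof. by move=> [Tl TM]; split=> //; exists M. Qed.

Lemma op_leW (T : F -> F) (M N : R) : M <= N -> op_le T M -> op_le T N.
Proof.
move=> MN [Tl TM]; split=> // x; apply: le_trans (TM x) _.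
by rewrite ler_wpM2r // lecR.
Qed.

Lemma op_le0 : op_le 0 0.
Proof.
split=> [a x y|x]; first by rewrite !scaler0 addr0.
by rewrite normr0 mul0r.
Qed.

Lemma op_le_id : op_le idfun 1.
Proof. by split=> // x; rewrite mul1r. Qed.

Lemma op_leD (S T : F -> F) (M N : R) : op_le S M -> op_le T N -> op_le (S + T) (M + N).
Proof.
move=> [Sl SM] [Tl TN]; split=> [a x y|x].
  by rewrite !fctE Sl Tl scalerDr addrACA.
by rewrite rmorphD mulrDl; apply: le_trans (ler_normD _ _) (lerD _ _).
Qed.

Lemma op_leZ (a : R[i]) (b : R) (T : F -> F) (M : R) :
  `|a| <= b%:C -> op_le T M -> op_le (a *: T) (b * M).
Proof.
move=> ab [Tl TM]; split=> [c x y|x].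
  by rewrite !fctE Tl scalerDr !scalerA mulrC.
rewrite !fctE normrZ rmorphM -mulrA; apply: ler_pM => //.
Qed.

Lemma op_le_sum (I : Type) (s : seq I) (T : I -> F -> F) (M : I -> R) :
  (forall i, op_le (T i) (M i)) -> op_le (\sum_(i <- s) T i) (\sum_(i <- s) M i).
Proof.
move=> TM; apply: (big_ind2 op_le) => //; first exact: op_le0.
by move=> *; apply: op_leD.
Qed.

Lemma op_le_comp (S T : F -> F) (M N : R) : 0 <= M ->
  op_le S M -> op_le T N -> op_le (S \o T) (M * N).
Proof.
move=> M0 [Sl SM] [Tl TN]; split=> [a x y|x] /=; first by rewrite Tl Sl.
apply: le_trans (SM _) _; rewrite rmorphM -mulrA ler_wpM2l //.
by rewrite ler0c.
Qed.

Lemma op_le_word (A : 'I_d -> F -> F) (M : R) (w : word d) : 0 <= M ->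
  (forall i, op_le (A i) M) -> op_le (opword A w) (M ^+ size w).
Proof.
move=> M0 AM; elim: w => [|i w IHw] /=; first exact: op_le_id.
by rewrite exprS; apply: op_le_comp.
Qed.

(** The bound comes from |S y|^2 = <T S y, y> <= M |S y| |y|, after dividing by |S y|. *)
Lemma op_le_adjoint (T S : F -> F) (M : R) : 0 <= M ->
  op_le T M -> is_adjoint T S -> op_le S M.
Proof.
move=> M0 [Tl TM] TS; split=> [a x y|y].
  by apply: dot_ext => v; rewrite -TS !dotDr !dotZr -!TS.
have [->|Sy] := eqVneq (S y) 0; first by rewrite normr0 mulr_ge0 // ler0c.
have Sy0 : 0 < `|S y| by rewrite normr_gt0.
rewrite -(ler_pM2l Sy0) -expr2 -[leLHS]ger0_norm ?exprn_ge0 // fock_norm -TS.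
apply: le_trans (cauchy_schwarz _ _) _; rewrite mulrA (mulrC `|S y|).
by rewrite ler_wpM2r.
Qed.

Lemma opnorm_le (T : F -> F) (M : R) : 0 <= M -> op_le T M -> opnorm T <= M.
Proof.
move=> M0 [Tl TM]; apply: ge_sup.
  exists (complex.Re `|T 0|); exists 0 => //=.
  by rewrite normr0.
move=> _ [x /= x1 <-]; have : `|T x| <= M%:C.
  by apply: le_trans (TM x) _; rewrite ler_piMr // ler0c.
by rewrite lecE => /andP[].
Qed.

Lemma opnorm_ge0 (T : F -> F) : 0 <= opnorm T.
Proof.
rewrite /opnorm; set S := [set _ | _ in _].
(* For a set without supremum, [sup] is 0 by default. *)
have [hS|] := pselect (has_sup S); last by move=> h; rewrite sup_out.
have S0 : S (complex.Re `|T 0|) by exists 0 => //=; rewrite normr0.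
apply: le_trans (ub_le_sup hS.2 S0).
by have := normr_ge0 (T 0); rewrite lecE => /andP[].
Qed.

Section Opeval.
Variable A : 'I_d -> F -> F.

Lemma opeval_linear : linear (opeval A).
Proof. exact: malg_eval_linear. Qed.

Lemma opevalU (w : word d) : opeval A << w >> = opword A w.
Proof.
by rewrite /opeval msuppU oner_eq0 big_seq_fset1 mcoeffU eqxx scale1r.
Qed.

Lemma opevalE (Q : ncpoly R d) x :
  opeval A Q x = \sum_(w <- msupp Q) Q@_w *: opword A w x.
Proof. by rewrite /opeval fct_sumE. Qed.

Hypothesis A_lin : forall i, linear (A i).

Lemma opeval_cons (j : 'I_d) (Q : ncpoly R d) : exists P, opeval A P = A j \o opeval A Q.
Proof.
exists (\sum_(w <- msupp Q) Q@_w *: << j :: w >>).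
rewrite (lin_sum opeval_linear); apply/funext => x /=.
rewrite fct_sumE opevalE (lin_sum (A_lin j)); apply: eq_bigr => w _.
by rewrite (linZ opeval_linear) opevalU (linZ (A_lin j)).
Qed.

End Opeval.

End Operators.

(** * Expansions in words and Wick polynomials *)

Lemma sum_geometric_le (R : realFieldType) (x : R) n :
  0 <= x -> x < 1 -> \sum_(k < n) x ^+ k <= (1 - x)^-1.
Proof.
move=> x0 x1; have y0 : 0 < 1 - x by rewrite subr_gt0.
rewrite -(ler_pM2r y0) mulVf ?gt_eqF // mulrC -opprB mulNr -subrX1 opprB.
by rewrite gerBl exprn_ge0.
Qed.

Section Expansion.
Variables (R : realType) (d : nat) (q : R) (F : qFock d q).
Local Open Scope complex_scope.
Local Notation dot := (fock_dot F).
Local Notation e_ := (ebasis F).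

Lemma dot_emb_supp (b : falg R d) (s : seq (word d)) (x : F) :
    (forall u, u \notin s -> b@_u = 0) -> (forall u, u \in s -> dot (e_ u) x = 0) ->
  dot (fock_emb F b) x = 0.
Proof.
move=> bs sx; rewrite fock_embS dot_suml big1 // => u _; rewrite dotZl.
have [/sx ->|/bs ->] := boolP (u \in s); by rewrite ?mulr0 ?mul0r.
Qed.

(* One Gram-Schmidt step per word. *)
Lemma ortho_proj (s : seq (word d)) (z : F) : exists2 b : falg R d,
  forall u, u \notin s -> b@_u = 0 &
  forall u, u \in s -> dot (e_ u) z = dot (e_ u) (fock_emb F b).
Proof.
elim: s z => [|w s IHs] z; first by exists 0 => // u _; rewrite mcoeff0.
have [bw bws hw] := IHs (e_ w); have [bz bzs hz] := IHs z.
pose g := e_ w - fock_emb F bw; pose h := z - fock_emb F bz.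
have gs u : u \in s -> dot (e_ u) g = 0 by move=> us; rewrite dotBr hw // subrr.
have hs u : u \in s -> dot (e_ u) h = 0 by move=> us; rewrite dotBr hz // subrr.
pose c := dot h g / dot g g.
have gc : dot g (h - c *: g) = 0.
  (* Here [e_ w] already lies in the span of the earlier vectors; [g] is then 0 and the value of [c]
     is irrelevant. *)
  have [g0|g0] := eqVneq (dot g g) 0; first by rewrite (dot_eq0 g0) linear0l.
  by rewrite dotC dotBl dotZl divfK // subrr rmorph0.
exists (bz + c *: (<< w >> - bw)) => u.
  rewrite inE negb_or => /andP[uw us].
  rewrite mcoeffD mcoeffZ mcoeffB mcoeffU bzs // bws // eq_sym (negbTE uw).
  by rewrite subrr mulr0 addr0.
have -> : fock_emb F (bz + c *: (<< w >> - bw)) = z - (h - c *: g).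
  by rewrite linearD linearZ_LR linearB /= opprB addrCA addrC /h subKr.
move=> us; rewrite dotBr; suff -> : dot (e_ u) (h - c *: g) = 0 by rewrite subr0.
have hgs v : v \in s -> dot (e_ v) (h - c *: g) = 0.
  by move=> vs; rewrite dotBr dotZr hs // gs // mulr0 subr0.
move: us; rewrite inE => /orP[/eqP ->|/hgs //].
have -> : e_ w = g + fock_emb F bw by rewrite subrK.
by rewrite dotDl gc add0r; apply: dot_emb_supp hgs.
Qed.

(** Project [z] onto the span of the words of length N. The remainder is orthogonal to these words
    by projection, and to all others because both [z] and its projection are, hence it is 0. *)
Lemma homogeneous_expansion (N : nat) (z : F) :
    (forall v, size v != N -> dot (e_ v) z = 0) ->
  exists c : N.-tuple 'I_d -> R[i], z = \sum_t c t *: e_ (tval t).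
Proof.
move=> zN; pose s := [seq tval t | t <- enum {: N.-tuple 'I_d}].
have sP v : (v \in s) = (size v == N).
  apply/mapP/eqP => [[t _ ->]|vN]; first by rewrite size_tuple.
  by exists (tcast vN (in_tuple v)); rewrite ?mem_enum //= val_tcast.
have [b bs bz] := ortho_proj s z.
exists (fun t => b@_(tval t)).
have -> : z = fock_emb F b.
  apply: dot_ext => v; have [vs|] := boolP (v \in s); first exact: bz.
  rewrite sP => vN; rewrite zN // dotC (dot_emb_supp bs) ?rmorph0 // => u.
  by rewrite sP => /eqP uN; rewrite dot_basis_size // uN eq_sym.
have {1}-> : b = \sum_(t : N.-tuple 'I_d) b@_(tval t) *: << tval t >>.
  apply/malgP => v; rewrite raddf_sum /=.
  under eq_bigr do rewrite mcoeffZ mcoeffU.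
  have [vN|vN] := boolP (size v == N).
    rewrite (bigD1 (tcast (eqP vN) (in_tuple v))) //= val_tcast eqxx mulr1.
    rewrite big1 ?addr0 // => t; rewrite -val_eqE /= val_tcast => /negbTE tv.
    by rewrite tv mulr0.
  rewrite bs ?sP // big1 // => t _; case: eqP => [tv|]; last by rewrite mulr0.
  by move: vN; rewrite -tv size_tuple eqxx.
by rewrite linear_sum; apply: eq_bigr => t _; rewrite linearZ_LR.
Qed.

Section RightAnnihilation.
Variable r : 'I_d -> F -> F.
Hypothesis hr : free_right_annihilation r.

Lemma r_lin i : linear (r i).
Proof. by have [[]] := hr i. Qed.

Lemma opword_r_lin u : linear (opword r u).
Proof.
elim: u => [//|i u IHu] a x y /=; by rewrite IHu r_lin.
Qed.

Lemma opword_rcons (u : word d) j x : opword r (rcons u j) x = opword r u (r j x).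
Proof. by elim: u => //= i u ->. Qed.

(** The last letter of [u] acts first, so the operator strips [u] off the right end; hence the
    induction from the right. *)
Lemma opword_r_cat (v u u' : word d) : size u = size u' ->
  opword r u (e_ (v ++ u')) = (u == u')%:R *: e_ v.
Proof.
elim/last_ind: u u' => [|u i IHu]; case/lastP => [|u' i'];
  rewrite ?size_rcons //; first by rewrite cats0 scale1r.
move=> [su]; rewrite opword_rcons -rcons_cat; have [_ _ ->] := hr i.
rewrite (linZ (opword_r_lin u)) IHu // scalerA -natrM mulnb eqseq_rcons andbC.
by rewrite [i == i']eq_sym.
Qed.

Lemma opword_r_short (u v : word d) : (size v < size u)%N -> opword r u (e_ v) = 0.
Proof.
elim/last_ind: u v => [//|u i IHu]; case/lastP => [|v j]; rewrite opword_rcons.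
  by have [_ -> _] := hr i; rewrite (lin0 (opword_r_lin u)).
rewrite !size_rcons => uv; have [_ _ ->] := hr i.
by rewrite (linZ (opword_r_lin u)) IHu // scaler0.
Qed.

End RightAnnihilation.

Section Bounds.
Variables (l ls r : 'I_d -> F -> F).
Hypothesis hls : left_creation ls.
Hypothesis hl : forall i, is_adjoint (ls i) (l i).
Hypothesis hr : free_right_annihilation r.

(** There are finitely many operators, so the sum of their bounds serves for all; absolute values
    are taken because the given bounds carry no sign. The [l i] inherit the bound as adjoints. *)
Lemma uniform_bound : exists2 rho : R, 1 <= rho &
  forall i, [/\ op_le (l i) rho, op_le (ls i) rho & op_le (r i) rho].
Proof.
have hM i : exists M : R, forall x, `|ls i x| <= M%:C * `|x| by have [[]] := hls i.
have hN i : exists M : R, forall x, `|r i x| <= M%:C * `|x| by have [[]] := hr i.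
have [M MP] := choice hM; have [N NP] := choice hN.
pose rho := 1 + \sum_i (`|M i| + `|N i|).
have rho0 : 0 <= \sum_i (`|M i| + `|N i|) by apply: sumr_ge0 => i _; rewrite addr_ge0.
have rho1 : 1 <= rho by rewrite lerDl.
have MN i : `|M i| + `|N i| <= rho.
  rewrite /rho (bigD1 i) //= addrCA lerDl addr_ge0 //.
  by apply: sumr_ge0 => j _; rewrite addr_ge0.
have lsb i : op_le (ls i) rho.
  apply: (@op_leW _ _ _ _ _ (M i)); last by split=> //; have [[]] := hls i.
  by apply: le_trans (MN i); apply: le_trans (ler_norm _) _; rewrite lerDl.
exists rho => // i; split => //.
  by apply: op_le_adjoint (lsb i) (hl i); apply: le_trans rho1.
apply: (@op_leW _ _ _ _ _ (N i)); last by split=> //; exact: r_lin.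
by apply: le_trans (MN i); apply: le_trans (ler_norm _) _; rewrite lerDr.
Qed.

Lemma l_basis (j : 'I_d) (u : word d) : l j (e_ u) =
  \sum_(k < size u) (q%:C ^+ k * (j == tnth (in_tuple u) k)%:R) *: e_ (del u k).
Proof.
apply: dot_ext => v; rewrite -hl; have [_ ->] := hls j.
rewrite dot_basis qform_cons dot_sumr; apply: eq_bigr => k _.
by rewrite dotZr dot_basis rmorphM rmorphXn rmorph_nat /= conj_realC.
Qed.

Hypothesis hq : `|q| < 1.

Lemma wick_bound (rho : R) : 1 <= rho ->
    (forall i, op_le (l i) rho) -> (forall i, op_le (ls i) rho) ->
  forall u, exists2 Q, op_le (opeval (qgaussian l ls) Q)
       ((rho + rho + (1 - `|q|)^-1) ^+ size u) &
     opeval (qgaussian l ls) Q (e_ [::]) = e_ u.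
Proof.
move=> rho1 lb lsb; set A := qgaussian l ls.
(* [K] closes the recursion: [rho + rho] pays for the factor [A j], and [c] bounds the geometric sum
   of the |q|^k over the deleted letters. *)
set c := (1 - `|q|)^-1; set K := rho + rho + c.
have c0 : 0 < c by rewrite invr_gt0 subr_gt0.
have rho0 : 0 <= rho by apply: le_trans rho1.
have K0 : 0 <= K by rewrite !addr_ge0 // ltW.
have K1 : 1 <= K by rewrite /K -addrA; apply: ler_wpDr rho1; rewrite addr_ge0 // ltW.
have Ab i : op_le (A i) (rho + rho) by apply: op_leD.
have A_lin i : linear (A i) by have [] := Ab i.
(* Strong induction on length, since the recursion uses both [u] and the shorter words [del u k]. *)
move=> u; have [n] := ubnP (size u); elim: n u => // n IHn [_|j u un].
  exists << [::] >>; rewrite opevalU //; exact: op_le_id.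
have [Q QK Qu] := IHn u un.
have hdel (k : 'I_(size u)) : exists P, op_le (opeval A P) (K ^+ (size u).-1) /\
    opeval A P (e_ [::]) = e_ (del u k).
  have [|P PK Pu] := IHn (del u k); first by rewrite size_del //; move: un => /=; lia.
  by exists P; rewrite size_del // in PK; split.
have [P PP] := choice hdel.
have [Q' Q'E] := opeval_cons A_lin j Q.
pose g (k : 'I_(size u)) := q%:C ^+ k * (j == tnth (in_tuple u) k)%:R.
have opE : opeval A (Q' - \sum_k g k *: P k) =
    opeval A Q' + -1 *: \sum_k g k *: opeval A (P k).
  rewrite (linB (opeval_linear A)) (lin_sum (opeval_linear A)) scaleN1r.
  by congr (_ - _); apply: eq_bigr => k _; rewrite (linZ (opeval_linear A)).
exists (Q' - \sum_k g k *: P k); rewrite opE.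
  have gk k : `|g k| <= (`|q| ^+ k)%:C.
    rewrite normrM normr_nat normrX norm_realC.
    by rewrite rmorphXn ler_piMr ?exprn_ge0 ?ler0c // lern1 leq_b1.
  apply: (@op_leW _ _ _ _ _ ((rho + rho) * K ^+ size u +
      1 * \sum_(k < size u) `|q| ^+ k * K ^+ (size u).-1)).
    rewrite mul1r -mulr_suml [size (j :: u)]/= (exprS K) [leRHS]mulrDl lerD2l.
    case: (u) => [|i v] /=; first by rewrite big_ord0 mul0r mulr_ge0 // ltW.
    apply: ler_pM.
    - by apply: sumr_ge0 => k _; rewrite exprn_ge0.
    - by rewrite exprn_ge0.
    - exact: sum_geometric_le.
    - by rewrite exprS ler_peMl // exprn_ge0.
  apply: op_leD; first by rewrite Q'E; apply: op_le_comp => //; rewrite addr_ge0.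
  apply: op_leZ; first by rewrite normrN normr1.
  by apply: op_le_sum => k; apply: op_leZ => //; have [] := PP k.
have -> : (opeval A Q' + -1 *: \sum_k g k *: opeval A (P k)) (e_ [::])
    = A j (e_ u) - \sum_k g k *: e_ (del u k).
  rewrite !fctE Q'E /= Qu scaleN1r fct_sumE; congr (_ - _).
  by apply: eq_bigr => k _; have [_ <-] := PP k.
have -> : A j (e_ u) = l j (e_ u) + ls j (e_ u) by [].
by have [_ ->] := hls j; rewrite l_basis addrAC subrr add0r.
Qed.

End Bounds.
End Expansion.

(** * Absolutely convergent families *)

Section AbsoluteSum.
Variables (R : realType) (I : choiceType) (b : I -> R) (S : R).
Local Open Scope complex_scope.
Hypothesis b_ge0 : forall i, 0 <= b i.
Hypothesis b_ub : forall J, partial_sum b J <= S.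
Hypothesis b_sup : forall eps, 0 < eps -> exists J, S - eps < partial_sum b J.

Lemma partial_sumE (V : zmodType) (x : I -> V) (J : {fset I}) :
  partial_sum x J = \sum_(i <- J) x i.
Proof. by rewrite /partial_sum big_seq_fsetE. Qed.

Lemma partial_sumD (V : zmodType) (x : I -> V) (J K : {fset I}) : (J `<=` K)%fset ->
  partial_sum x K = partial_sum x J + partial_sum x (K `\` J)%fset.
Proof.
move=> JK; rewrite !partial_sumE (big_fsetID _ (mem J)) /=.
congr (_ + _); apply: eq_fbigl => i; rewrite !inE /= ?(andb_idl (fsubsetP JK _)) //.
by rewrite andbC.
Qed.

Lemma partial_sum_mono (J K : {fset I}) : (J `<=` K)%fset ->
  partial_sum b J <= partial_sum b K.
Proof.
move=> JK; rewrite (partial_sumD b JK) lerDl partial_sumE.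
by apply: sumr_ge0 => i _; apply: b_ge0.
Qed.

Lemma cvg_totally_tail (f : {fset I} -> R) :
    (forall J, 0 <= f J <= S - partial_sum b J) ->
  (f @ totally --> (0 : R))%classic.
Proof.
move=> fb; apply/cvgrPdist_lt => eps eps0; have [J0 hJ0] := b_sup eps0.
exists J0 => // J /= J0J; have /andP[f0 fJ] := fb J.
rewrite sub0r normrN ger0_norm //; apply: le_lt_trans fJ _.
by rewrite ltrBlDr -ltrBlDl; apply: lt_le_trans hJ0 (partial_sum_mono J0J).
Qed.

Section Sum.
Variables (V : completeNormedModType R[i]) (a : I -> V) (c : R).
Hypothesis c_ge0 : 0 <= c.
Hypothesis ab : forall i, `|a i| <= (b i * c)%:C.

Lemma partial_sum_dist (J K : {fset I}) : (J `<=` K)%fset ->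
  `|partial_sum a K - partial_sum a J| <= ((S - partial_sum b J) * c)%:C.
Proof.
move=> JK; rewrite (partial_sumD a JK) addrAC subrr add0r partial_sumE.
apply: le_trans (ler_norm_sum _ _ _) _.
apply: (@le_trans _ _ (\sum_(i <- (K `\` J)%fset) (b i * c)%:C)).
  by apply: ler_sum => i _.
rewrite -rmorph_sum lecR -mulr_suml ler_wpM2r // lerBrDl -partial_sumE.
by rewrite -partial_sumD.
Qed.

(** Partial sums are Cauchy along finite sets because the tails of [b] dominate their differences;
    the bound at [J] passes to the limit through larger sets. In [operator_series], [c] is the norm
    of the vector acted on. *)
Lemma partial_sum_limit : exists s : V, forall J,
  `|s - partial_sum a J| <= ((S - partial_sum b J) * c)%:C.
Proof.
have tail eps : 0 < eps -> exists J, (S - partial_sum b J) * c < eps.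
  (* [c] may be 0, so the division is by [c + 1]. *)
  move=> eps0; have c1 : 0 < c + 1 by rewrite ltr_wpDl.
  have [|J hJ] := b_sup (eps := eps / (c + 1)); first by rewrite divr_gt0.
  exists J; apply: (@le_lt_trans _ _ ((S - partial_sum b J) * (c + 1))).
    by rewrite ler_wpM2l ?subr_ge0 // lerDl.
  by rewrite -ltr_pdivlMr // ltrBlDr -ltrBlDl.
have realC (eps : R[i]) : 0 < eps -> exists2 e : R, 0 < e & eps = e%:C.
  case: eps => x y; rewrite ltcE /= => /andP[/eqP -> x0]; by exists x.
have /cauchy_cvg/cvg_ex[s hs] : cauchy (partial_sum a @ totally).
  apply: cauchy_exP => _ /realC[eps eps0 ->].
  have [J hJ] := tail _ eps0; exists (partial_sum a J).
  exists J => // K /= JK; rewrite -ball_normE /= distrC.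
  by apply: le_lt_trans (partial_sum_dist JK) _; rewrite ltcR.
exists s => J; apply/ler_addgt0Pr => _ /realC[eps eps0 ->].
have : (\forall K \near totally, `|s - partial_sum a K| < eps%:C)%classic.
  by move/cvgrPdist_lt : hs; apply; rewrite ltcR.
move=> [K0 _ hK0]; pose K := (K0 `|` J)%fset.
have JK : (J `<=` K)%fset by rewrite fsubsetUr.
have := hK0 K (fsubsetUl _ _) => /ltW sK.
rewrite -(subrK (partial_sum a K) s) -addrA addrC.
by apply: le_trans (ler_normD _ _) (lerD (partial_sum_dist JK) sK).
Qed.

Lemma cvg_partial_sum (s : V) :
    (forall J, `|s - partial_sum a J| <= ((S - partial_sum b J) * c)%:C) ->
  (partial_sum a @ totally --> s)%classic.
Proof.
move=> hs; apply/cvgrPdist_lt => eps.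
case: eps => x y; rewrite ltcE /= => /andP[/eqP -> x0].
have c1 : 0 < c + 1 by rewrite ltr_wpDl.
have [|J hJ] := b_sup (eps := x / (c + 1)); first by rewrite divr_gt0.
exists J => // K /= JK; apply: le_lt_trans (hs K) _; rewrite complexr0 ltcR.
apply: (@le_lt_trans _ _ ((S - partial_sum b J) * (c + 1))).
  apply: ler_pM; rewrite ?subr_ge0 ?lerDl //.
  by rewrite lerB // partial_sum_mono.
by rewrite -ltr_pdivlMr // ltrBlDr -ltrBlDl.
Qed.

End Sum.

(** The tool for identities about limits: a defect dominated by every tail must vanish. It yields
    linearity of the limit operator and its commutation relations. *)
Lemma tail_eq0 (V : normedModType R[i]) (v : V) (c : R) : 0 <= c ->
  (forall J, `|v| <= ((S - partial_sum b J) * c)%:C) -> v = 0.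
Proof.
move=> c0 hv; apply/eqP; rewrite -normr_le0; apply/ler_addgt0Pr.
case=> x y; rewrite ltcE /= => /andP[/eqP -> x0].
have c1 : 0 < c + 1 by rewrite ltr_wpDl.
have [|J hJ] := b_sup (eps := x / (c + 1)); first by rewrite divr_gt0.
rewrite add0r; apply: le_trans (hv J) _; rewrite complexr0 lecR ltW //.
apply: (@le_lt_trans _ _ ((S - partial_sum b J) * (c + 1))).
  by rewrite ler_wpM2l ?subr_ge0 // lerDl.
by rewrite -ltr_pdivlMr // ltrBlDr -ltrBlDl.
Qed.

End AbsoluteSum.

(** * Gaussian decay against exponential growth *)

Section Weights.
Variables (R : realType).

(** Consecutive terms have ratio L |q|^(n+1), which is at most 1 once n >= p, where L |q|^p <= 1. *)
Lemma gauss_decay (q L : R) : `|q| < 1 -> 0 <= L ->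
  exists2 C, 0 <= C & forall n, L ^+ n * `|q| ^+ (n.+1 * n)./2 <= C.
Proof.
move=> q1 L0.
have [p hp] : exists p : nat, L * `|q| ^+ p <= 1.
  have L1 : 0 < L + 1 by rewrite ltr_wpDl.
  have /cvgrPdist_lt /(_ (L + 1)^-1) : (GRing.exp `|q| : R ^nat) @ \oo --> (0 : R).
    by apply: cvg_expr; rewrite normr_id.
  rewrite invr_gt0 L1 => /(_ isT) [p _ /(_ p (leqnn p))] /=.
  rewrite sub0r normrN normrX normr_id => hp; exists p.
  apply: (@le_trans _ _ ((L + 1) * `|q| ^+ p)).
    by rewrite ler_wpM2r ?exprn_ge0 // lerDl.
  by rewrite -ler_pdivlMl // mulr1 ltW.
pose a n := L ^+ n * `|q| ^+ (n.+1 * n)./2.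
have a0 n : 0 <= a n by rewrite mulr_ge0 ?exprn_ge0.
have aS n : a n.+1 = a n * (L * `|q| ^+ n.+1).
  have e : ((n.+2 * n.+1)./2 = (n.+1 * n)./2 + n.+1)%N.
    have -> : (n.+2 * n.+1 = n.+1 * n + n.+1.*2)%N by lia.
    by rewrite halfD odd_double andbF doubleK add0n.
  by rewrite /a e exprS exprD; ring.
(* The sum of the first p + 1 terms bounds each of them, and later terms do not increase. *)
exists (\sum_(k < p.+1) a k); first exact: sumr_ge0.
elim=> [|n IHn]; first by rewrite big_ord_recl lerDl; apply: sumr_ge0.
have [np|np] := leqP n.+1 p.
  rewrite (bigD1 (Ordinal (np : n.+1 < p.+1)%N)) //= lerDl.
  by apply: sumr_ge0.
apply: le_trans IHn; rewrite -/(a n.+1) aS ler_piMr //.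
apply: le_trans hp; rewrite ler_wpM2l //.
by apply: ler_wiXn2l => //; [exact: ltW|exact: ltnW].
Qed.

(** At most (d+1)^n words have length n, so they contribute at most 2^-n. Using d + 1 in place of d
    keeps the base invertible when d = 0. *)
Lemma word_weight_sum (d : nat) (J : {fset word d}) :
  \sum_(w <- J) ((2 * d.+1)%:R^-1) ^+ size w <= 2 :> R.
Proof.
set c := (_^-1); have c0 : 0 <= c by rewrite invr_ge0.
pose N := (\max_(w <- J) size w).+1.
have wN w : w \in J -> (size w < N)%N.
  by move=> wJ; rewrite ltnS; apply: leq_bigmax_seq.
have -> : \sum_(w <- J) c ^+ size w =
    \sum_(n < N) \sum_(w <- J | size w == n) c ^+ n.
  rewrite (exchange_big_dep xpredT) //= [LHS]big_seq [RHS]big_seq.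
  apply: eq_bigr => w /wN sw.
  by rewrite (big_pred1 (Ordinal sw)) // => n; rewrite -val_eqE eq_sym.
have h (n : nat) : \sum_(w <- J | size w == n) c ^+ n <= 2^-1 ^+ n.
  rewrite big_const_seq iter_addr_0 -[X in X <= _]mulr_natr.
  have cnt : (count (fun w : word d => size w == n) J <= d.+1 ^ n)%N.
    rewrite -size_filter; apply: (@leq_trans (d ^ n)).
      have <- : size [seq tval t | t <- enum {: n.-tuple 'I_d}] = (d ^ n)%N.
        by rewrite size_map -cardE card_tuple card_ord.
      apply: uniq_leq_size; first by rewrite filter_uniq // fset_uniq.
      move=> w; rewrite mem_filter => /andP[/eqP sw _]; apply/mapP.
      by exists (tcast sw (in_tuple w)); rewrite ?mem_enum //= val_tcast.
    by case: (n) => // k; rewrite leq_exp2r.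
  apply: (@le_trans _ _ (c ^+ n * (d.+1 ^ n)%:R)).
    by rewrite ler_wpM2l ?exprn_ge0 // ler_nat.
  by rewrite natrX -exprMn /c natrM invfM -mulrA mulVf ?mulr1 ?pnatr_eq0.
apply: (@le_trans _ _ (\sum_(n < N) 2^-1 ^+ n)); first exact: ler_sum.
apply: le_trans (sum_geometric_le _ _ _) _; [by lra|by lra|].
have -> : 1 - 2^-1 = 2^-1 :> R by lra.
by rewrite invrK.
Qed.

End Weights.

(** * The dual system and its series *)

Section DualSystem.
Variables (R : realType) (d : nat) (q : R) (F : qFock d q).
Local Open Scope complex_scope.
Local Notation dot := (fock_dot F).
Local Notation e_ := (ebasis F).

Lemma dot_basis_vacuum (u : word d) : dot (e_ u) (e_ [::]) = (u == [::])%:R.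
Proof.
case: u => [|j u]; first exact: dot_vacuum.
by rewrite dot_basis_size.
Qed.

Lemma dual_formula_vacuum (i : 'I_d) (v : word d) :
  dot (dual_formula F i v) (e_ [::]) =
  \sum_(f : {ffun 'I_(size v).+1 -> 'I_(size v).+1} |
        inB f && [forall x, f x != x]) dual_term q%:C (nth i (i :: rev v)) f.
Proof.
rewrite dot_suml [RHS]big_mkcondr; apply: eq_bigr => f _ /=.
rewrite dotZl dot_basis_vacuum.
have -> : (word_singletons i f == [::]) = [forall x, f x != x].
  rewrite -size_eq0 size_map size_rev -cardE.
  apply/eqP/forallP => [h x|h]; last by apply: eq_card0 => x; apply/negbTE/h.
  by apply/negP => fx; have := card0_eq h x; rewrite inE /= fx.
by case: ifP => _; rewrite ?mulr1 ?mulr0.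
Qed.

Lemma dual_formula_even (i : 'I_d) (v : word d) :
  ~~ odd (size v) -> dot (dual_formula F i v) (e_ [::]) = 0.
Proof.
move=> ov; rewrite dual_formula_vacuum big_pred0 // => f.
apply/negP => /andP[fB /forallP fF]; move: ov; rewrite (inB_size fB fF).
by rewrite oddD /= addbN addbb.
Qed.

(** The middle letter [j] is the partner of vertex 0, which carries [i]; the halves [v] and [w] are
    matched with each other, read backwards. *)
Lemma dual_formula_odd (i j : 'I_d) (v w : word d) : size v = size w ->
  dot (dual_formula F i (v ++ j :: w)) (e_ [::]) =
    xi_coef q w * (i == j)%:R * dot (e_ v) (e_ w).
Proof.
move=> vw; rewrite dual_formula_vacuum.
have : size (v ++ j :: w) = (size w + (size w).+1)%N by rewrite size_cat vw.
have : forall k, nth i (i :: rev (v ++ j :: w)) k = nth i (i :: rev w ++ j :: rev v) k.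
  by move=> k; rewrite rev_cat rev_cons cat_rcons.
(* The size occurs in the type of [f], so letters and size are generalised before substituting n =
   2m + 1. *)
move: (nth i (i :: rev (v ++ j :: w))) (size (v ++ j :: w)) => a n ha hn; subst n.
rewrite sum_dual_term !ha /= nth_cat size_rev ltnn subnn /= (eq_sym j).
have -> : dot (e_ v) (e_ w) = permsum q%:C (size w)
    (fun k => nth i w (size w - k.+1)%N) (fun k => nth i v (size w - k.+1)%N).
  by rewrite permsum_rev permsumC dot_basis (qform_permsum _ i).
congr (_ * _).
apply: eq_permsum => k kw; rewrite ha /= nth_cat size_rev.
  by rewrite kw nth_rev // vw.
have -> : ((size w).+1 + k < size w)%N = false by lia.
have -> : ((size w).+1 + k - size w = k.+1)%N by lia.
by rewrite /= nth_rev vw.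
Qed.

End DualSystem.

(** * From dual to conjugate systems, and bounds on the summands *)

Section Main.
Variables (R : realType) (d : nat) (q : R) (F : qFock d q).
Local Open Scope complex_scope.
Local Notation dot := (fock_dot F).
Local Notation e_ := (ebasis F).
Variables (l ls : 'I_d -> F -> F).
Hypothesis hls : left_creation ls.
Hypothesis hl : forall i, is_adjoint (ls i) (l i).
Local Notation A := (qgaussian l ls).

Lemma qgaussian_lin i : linear (A i).
Proof.
have [[lsl [M hM]] _] := hls i.
move=> a x y; rewrite /qgaussian !fctE lsl.
suff -> : l i (a *: x + y) = a *: l i x + l i y by rewrite scalerDr addrACA.
by apply: dot_ext => v; rewrite -hl !dotDr !dotZr -!hl.
Qed.

Lemma qgaussian_adjoint i : is_adjoint (A i) (A i).
Proof.
move=> x y; rewrite /qgaussian !fctE dotDl dotDr hl addrC; congr (_ + _).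
by rewrite dotC -hl -dotC.
Qed.

Lemma fock_algD (x y : F) : fock_alg F x -> fock_alg F y -> fock_alg F (x + y).
Proof. by move=> [a _ <-] [b _ <-]; exists (a + b); rewrite ?linearD. Qed.

Lemma fock_alg_sum (I : Type) (s : seq I) (g : I -> F) :
  (forall i, fock_alg F (g i)) -> fock_alg F (\sum_(i <- s) g i).
Proof.
move=> gF; apply: (big_ind (fock_alg F)) => [||i _]; last exact: gF.
  by exists 0 => //; rewrite linear0.
exact: fock_algD.
Qed.

Lemma fock_algZ a (x : F) : fock_alg F x -> fock_alg F (a *: x).
Proof. by move=> [b _ <-]; exists (a *: b); rewrite ?linearZ_LR. Qed.

Lemma fock_alg_basis w : fock_alg F (e_ w).
Proof. by exists << w >>. Qed.

Lemma fock_alg_qgaussian i x : fock_alg F x -> fock_alg F (A i x).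
Proof.
move=> [b _ <-]; rewrite fock_embS (lin_sum (qgaussian_lin i)).
apply: fock_alg_sum => w; rewrite (linZ (qgaussian_lin i)); apply: fock_algZ.
rewrite /qgaussian fctE (l_basis hls hl); have [_ ->] := hls i.
apply: fock_algD; last exact: fock_alg_basis.
by apply: fock_alg_sum => k; apply: fock_algZ; apply: fock_alg_basis.
Qed.

(** Moving one self-adjoint [A j] across the inner product produces the commutator of [D i] and
    [A j], whose rank-one value is the new term of the Leibniz rule. *)
Lemma conjugate_system_of_dual (D : 'I_d -> unbounded_op F) (xi : 'I_d -> F) :
    normalized_dual_system A D -> (forall i, adjoint_at (D i) (e_ [::]) (xi i)) ->
  conjugate_system A xi.
Proof.
move=> hD hxi i; have [DF D0 _ DA] := hD i.
(* The vacuum is generalised to any [y] in the algebraic Fock space, since each step replaces [y] by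
   [A j y]. At the vacuum the [D i y] term vanishes. *)
have key w y : fock_alg F y -> dot (opword A w (xi i)) y =
    dot (opword A w (e_ [::])) (D i y) +
    \sum_(p <- fdq_word i w) dot (opword A p.1 (e_ [::])) y * tau (opword A p.2).
  elim: w y => [|j w IHw] y yF /=.
    by rewrite big_nil addr0 dotC -hxi; [rewrite -dotC|exact: DF].
  rewrite (qgaussian_adjoint j) IHw; last exact: fock_alg_qgaussian.
  have -> : D i (A j y) = A j (D i y) + (i == j)%:R *: (dot y (e_ [::]) *: e_ [::]).
    by rewrite -DA // addrC subrK.
  rewrite dotDr -qgaussian_adjoint -!addrA; congr (_ + _).
  rewrite big_cat big_map /=; congr (_ + _); last first.
    by apply: eq_bigr => p _; rewrite -qgaussian_adjoint.
  case: eqP => _; last by rewrite big_nil scale0r linear0r.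
  by rewrite big_seq1 scale1r dotZr -dotC.
move=> Q; rewrite opevalE dot_suml.
have lin := @malg_eval_linear (word d * word d)%type R[i] R[i]^o
  (fun p => tau (opword A p.1) * tau (opword A p.2)).
transitivity (\sum_(w <- msupp Q) Q@_w * \sum_(p <- fdq_word i w)
   tau (opword A p.1) * tau (opword A p.2)).
  apply: eq_bigr => w _; rewrite dotZl key; last exact: fock_alg_basis.
  by rewrite D0 linear0r add0r.
apply: esym; rewrite /tau2_eval; apply: etrans (lin_sum lin _ _ _) _.
apply: eq_bigr => w _; apply: etrans (linZ lin _ _) _; congr (_ * _).
apply: etrans (lin_sum lin _ _ _) _; apply: eq_bigr => p _.
by rewrite msuppU oner_eq0 big_seq_fset1 mcoeffU eqxx scale1r.
Qed.

Variable r : 'I_d -> F -> F.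
Hypothesis hr : free_right_annihilation r.
Variable rs : word d -> F -> F.
Hypothesis hrs : forall u, is_adjoint (opword r u) (rs u).

Lemma dot_rs_cat (v u w : word d) i : size u = (size w).+1 ->
  dot (e_ (v ++ u)) (rs (i :: w) (e_ w)) = (i :: w == u)%:R * dot (e_ v) (e_ w).
Proof. by move=> uw; rewrite -hrs (opword_r_cat hr) // dotZl. Qed.

(** The operator [opword r (i :: w)] removes |w| + 1 letters or kills the vector, and words of
    different lengths are orthogonal. *)
Lemma dot_rs_size (v w : word d) i : size v != (size w + (size w).+1)%N ->
  dot (e_ v) (rs (i :: w) (e_ w)) = 0.
Proof.
move=> vw; have [vs|vs] := ltnP (size v) (size w).+1.
  by rewrite -hrs (opword_r_short hr) // linear0l.
rewrite -(cat_take_drop (size v - (size w).+1) v) dot_rs_cat ?size_drop ?subKn //.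
rewrite dot_basis_size ?mulr0 // size_takel ?leq_subr //.
by apply: contra vw => /eqP vw; apply/eqP; lia.
Qed.

Hypothesis hq : `|q| < 1.

(* The coefficient of t in z = r_iw^* e_w is bounded through r_t z = c_t e_0. *)
Lemma dual_summand_bound : exists2 L : R, 0 <= L & forall i w, exists2 Q,
  op_le (opeval A Q) (L ^+ (size w + (size w).+1)) &
  opeval A Q (e_ [::]) = rs (i :: w) (e_ w).
Proof.
have [rho rho1 rhoP] := uniform_bound hls hl hr.
have rho0 : 0 <= rho by apply: le_trans rho1.
have lb i : op_le (l i) rho by have [] := rhoP i.
have lsb i : op_le (ls i) rho by have [] := rhoP i.
have rb i : op_le (r i) rho by have [] := rhoP i.
have W := wick_bound hls hl hq rho1 lb lsb.
set K := rho + rho + _ in W.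
have K0 : 0 <= K by rewrite !addr_ge0 // invr_ge0 subr_ge0 ltW.
(* There are d^N words of length N, each with coefficient at most rho^N rho^N and Wick polynomial of
   norm at most K^N. *)
exists (d%:R * (rho * rho * K)); first by rewrite !mulr_ge0.
move=> i w; set N := (size w + _)%N; set z := rs _ _.
have [c zc] : exists c : N.-tuple 'I_d -> R[i], z = \sum_t c t *: e_ (tval t).
  by apply: homogeneous_expansion => v vN; apply: dot_rs_size.
have ew (v : word d) : `|e_ v| <= (rho ^+ size v)%:C.
  elim: v => [|j v IHv]; first by rewrite norm_vacuum.
  have [_ <-] := hls j; rewrite exprS rmorphM; have [_ lsM] := lsb j.
  by apply: le_trans (lsM _) _; rewrite ler_wpM2l // ler0c.
have zb : `|z| <= (rho ^+ N)%:C.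
  have [_ h] := op_le_adjoint (exprn_ge0 _ rho0) (op_le_word (i :: w) rho0 rb) (hrs _).
  rewrite /N addnC exprD rmorphM; apply: le_trans (h _) _.
  by rewrite ler_wpM2l // ler0c exprn_ge0.
have cb (t : N.-tuple 'I_d) : `|c t| <= (rho ^+ N * rho ^+ N)%:C.
  have -> : `|c t| = `|opword r t z|.
    rewrite zc (lin_sum (opword_r_lin hr t)) (bigD1 t) //= big1 ?addr0.
      rewrite (linZ (opword_r_lin hr t)) (opword_r_cat hr [::]) // eqxx scale1r.
      by rewrite normrZ norm_vacuum mulr1.
    move=> u ut; rewrite (linZ (opword_r_lin hr t)) (opword_r_cat hr [::]) ?size_tuple //.
    by rewrite eq_sym val_eqE (negbTE ut) scale0r scaler0.
  have [_ h] := op_le_word t rho0 rb; apply: le_trans (h z) _.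
  by rewrite size_tuple rmorphM ler_wpM2l // ler0c exprn_ge0.
have WN (t : N.-tuple 'I_d) : exists Q, op_le (opeval A Q) (K ^+ N) /\
    opeval A Q (e_ [::]) = e_ (tval t).
  by have [Q QK Qe] := W t; exists Q; rewrite size_tuple in QK.
have [Q QP] := choice WN.
have QE : opeval A (\sum_t c t *: Q t) = \sum_t c t *: opeval A (Q t).
  rewrite (lin_sum (opeval_linear A)); apply: eq_bigr => t _.
  by rewrite (linZ (opeval_linear A)).
exists (\sum_t c t *: Q t); rewrite QE; last first.
  by rewrite fct_sumE zc; apply: eq_bigr => t _; have [_ <-] := QP t.
have -> : (d%:R * (rho * rho * K)) ^+ N =
    \sum_(t : N.-tuple 'I_d) rho ^+ N * rho ^+ N * K ^+ N.
  by rewrite sumr_const card_tuple card_ord -[RHS]mulr_natl natrX !exprMn.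
by apply: op_le_sum => t; apply: op_leZ (cb t) _; have [] := QP t.
Qed.

(** Gaussian decay is applied with base 2(d+1)L^2: this absorbs L^(2m) and leaves a factor
    (2(d+1))^-m, summable over words. *)
Lemma dual_series_weights : exists2 C : R, 0 <= C & forall i w, exists2 Q,
  op_le (xi_coef q w *: opeval A Q) (C * (2 * d.+1)%:R^-1 ^+ size w) &
  opeval A Q (e_ [::]) = rs (i :: w) (e_ w).
Proof.
have [L L0 hL] := dual_summand_bound.
have [C C0 hC] := gauss_decay hq (mulr_ge0 (mulr_ge0 L0 L0) (ler0n R (2 * d.+1))).
exists (L * C); first exact: mulr_ge0.
move=> i w; have [Q QL Qe] := hL i w; exists Q => //.
set c := (2 * d.+1)%:R in hC *.
have c0 : 0 < c :> R by rewrite ltr0n.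
pose p := `|q| ^+ ((size w).+1 * size w)./2.
apply: (@op_leW _ _ _ _ _ (p * L ^+ (size w + (size w).+1))).
  rewrite -(ler_pM2r (exprn_gt0 (size w) c0)) -[leRHS]mulrA -exprMn mulVf ?gt_eqF //.
  rewrite expr1n mulr1; apply: le_trans (ler_wpM2l L0 (hC (size w))).
  by rewrite !exprMn exprD exprS /p le_eqVlt; apply/orP; left; apply/eqP; ring.
apply: op_leZ => //; rewrite /xi_coef normrM normrX normrN1 expr1n mul1r.
rewrite normrX norm_realC.
by rewrite rmorphXn.
Qed.

Lemma dual_functional (i : 'I_d) (D : unbounded_op F) (xi : F)
    (hDdom : udom D = fock_alg F) (hD0 : D (e_ [::]) = 0)
    (hDw : forall w, (0 < size w)%N -> D (e_ w) = dual_formula F i w) :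
    (partial_sum (fun w => xi_coef q w *: rs (i :: w) (e_ w)) @ totally --> xi)%classic ->
  adjoint_at D (e_ [::]) xi.
Proof.
move=> hxi.
(* By Cauchy-Schwarz, pairing with [e_ v] is continuous, so it suffices that its values on partial
   sums are constant from [J] on. *)
have lim v (z : R[i]) J : (forall K, (J `<=` K)%fset ->
    dot (e_ v) (partial_sum (fun w => xi_coef q w *: rs (i :: w) (e_ w)) K) = z) ->
    dot (e_ v) xi = z.
  move=> hz; apply/eqP; rewrite -subr_eq0 -normr_le0; apply/ler_addgt0Pr => eps eps0.
  have v1 : 0 < `|e_ v| + 1 by rewrite ltr_wpDl.
  move/cvgrPdist_lt : hxi => /(_ (eps / (`|e_ v| + 1))).
  rewrite divr_gt0 // => /(_ isT) [J0 _ hJ0].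
  have := hJ0 (J `|` J0)%fset (fsubsetUr _ _).
  rewrite ltr_pdivlMr // add0r -(hz _ (fsubsetUl J J0)) -dotBr => h.
  apply: le_trans (cauchy_schwarz _ _) _; apply: le_trans (ltW h); rewrite mulrC.
  by rewrite ler_wpM2l // lerDl.
have Dlin (b : falg R d) : D (fock_emb F b) = \sum_(w <- msupp b) b@_w *: D (e_ w).
  rewrite fock_embS; elim: (enum_fset (msupp b)) => [|w s IHs].
    rewrite !big_nil; have := ufun_linear (u := D) (-1) (udom0 D) (udom0 D).
    by rewrite scaler0 addr0 scaleN1r addNr.
  rewrite !big_cons ufun_linear ?IHs //; rewrite hDdom; first exact: fock_alg_basis.
  by apply: fock_alg_sum => u; apply: fock_algZ; apply: fock_alg_basis.
suff key v : dot (D (e_ v)) (e_ [::]) = dot (e_ v) xi.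
  move=> x; rewrite hDdom => -[b _ <-]; rewrite Dlin fock_embS !dot_suml.
  by apply: eq_bigr => w _; rewrite !dotZl key.
have [ov|ov] := boolP (odd (size v)); last first.
  have -> : dot (D (e_ v)) (e_ [::]) = 0.
    case: v ov => [|j v] ov; first by rewrite hD0 linear0l.
    by rewrite hDw // dual_formula_even.
  apply/esym/(lim _ _ fset0) => K _; rewrite partial_sumE dot_sumr big1 // => w _.
  rewrite dotZr dot_rs_size ?mulr0 //; apply: contra ov => /eqP ->.
  by rewrite oddD /= addbN addbb.
(* Split [v] at its middle letter; only the summand indexed by the right half [w] pairs nontrivially
   with [e_ v]. *)
have [v1 [j [w [ev vw]]]] : exists v1 j w, v = v1 ++ j :: w /\ size v1 = size w.
  have vh : ((size v)./2 < size v)%N by move: ov; lia.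
  case E : (drop (size v)./2 v) => [|j w].
    by have := size_drop (size v)./2 v; rewrite E /=; lia.
  exists (take (size v)./2 v), j, w; rewrite -E cat_take_drop; split => //.
  have := size_drop (size v)./2 v; rewrite E size_takel ?(ltnW vh) //=; lia.
rewrite hDw; last by rewrite ev size_cat addnS.
rewrite ev dual_formula_odd //; apply/esym/(lim _ _ [fset w]%fset) => K.
rewrite fsub1set => wK; rewrite partial_sumE dot_sumr (bigD1_seq w) ?fset_uniq //=.
rewrite big1 ?addr0.
  rewrite dotZr dot_rs_cat // eqseq_cons eqxx andbT -mulrA; congr (_ * _).
  by rewrite /xi_coef rmorphM !rmorphXn rmorphN1 /= conj_realC.
move=> u uw; rewrite dotZr; have [su|su] := eqVneq (size u) (size w).
  by rewrite dot_rs_cat /= ?su // eqseq_cons (negbTE uw) andbF mul0r mulr0.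
by rewrite dot_rs_size ?mulr0 // size_cat /= vw; lia.
Qed.

End Main.

(** * Summation of the operators *)

Section OperatorSeries.
Variables (R : realType) (d : nat) (q : R) (F : qFock d q).
Variables (I : choiceType) (b : I -> R) (S : R).
Local Open Scope complex_scope.
Hypothesis b_ub : forall J, partial_sum b J <= S.
Hypothesis b_sup : forall eps, 0 < eps -> exists J, S - eps < partial_sum b J.
Variable (T : I -> F -> F).
Hypothesis Tb : forall i, op_le (T i) (b i).

Let norm_Re (x : F) : `|x| = (complex.Re `|x|)%:C.
Proof. by rewrite RRe_real // normr_real. Qed.

Let Re_norm_ge0 (x : F) : 0 <= complex.Re `|x|.
Proof. by have := normr_ge0 x; rewrite lecE => /andP[]. Qed.

Lemma op_le_partial_sum J : op_le (partial_sum T J) (partial_sum b J).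
Proof. by rewrite !partial_sumE; apply: op_le_sum. Qed.

(* b need not be the family of operator norms, only a summable majorant with
   unordered sum S; this makes the tail estimate uniform. *)
Lemma operator_series : exists X : F -> F,
  forall J, op_le (X - partial_sum T J) (S - partial_sum b J).
Proof.
have hX x : exists s : F, forall J, `|s - partial_sum (fun i => T i x) J|
    <= ((S - partial_sum b J) * complex.Re `|x|)%:C.
  apply: partial_sum_limit => // i; rewrite rmorphM /= -norm_Re.
  by have [] := Tb i.
have [X XP] := choice hX; exists X => J.
have Xn K x : `|(X - partial_sum T K) x| <= (S - partial_sum b K)%:C * `|x|.
  have := XP x K; rewrite rmorphM /= -norm_Re; congr (`|_ - _| <= _).
  by rewrite !partial_sumE fct_sumE.
split => // a x y.
have X_lin : X (a *: x + y) = a *: X x + X y.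
  apply/eqP; rewrite -subr_eq0; apply/eqP.
  (* Partial sums are linear, so the linearity defect of [X] is that of the error [X - P]; [c]
     collects the three norms that bound it. *)
  pose c := complex.Re `|a *: x + y| + (complex.Re `|a *: x| + complex.Re `|y|).
  apply: (tail_eq0 b_ub b_sup (c := c)) => [|K]; first by rewrite !addr_ge0 ?Re_norm_ge0.
  have [pl _] := op_le_partial_sum K; set P := partial_sum T K in pl *.
  have -> : X (a *: x + y) - (a *: X x + X y) =
      (X - P) (a *: x + y) - (a *: (X - P) x + (X - P) y).
    by rewrite !fctE pl scalerBr addrACA -opprD opprB addrA subrK.
  move: (S - _) (Xn K) => s Xs; rewrite rmorphM /c !rmorphD /= -!norm_Re !mulrDr.
  apply: le_trans (ler_normB _ _) (lerD (Xs _) _).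
  apply: le_trans (ler_normD _ _) (lerD _ (Xs _)).
  by rewrite !normrZ mulrCA ler_wpM2l.
have [pl _] := op_le_partial_sum J.
by rewrite !fctE X_lin pl scalerBr addrACA opprD.
Qed.

Variables (X : F -> F).
Hypothesis XP : forall J, op_le (X - partial_sum T J) (S - partial_sum b J).

Lemma operator_series_bounded : op_le X S.
Proof.
have e : X - partial_sum T fset0 = X by rewrite partial_sumE big_seq_fset0 subr0.
by have := XP fset0; rewrite e partial_sumE big_seq_fset0 subr0.
Qed.

(** The partial sums commute with [Y], so the commutator of [X] and [Y] is that of an error term and
    is dominated by every tail. *)
Lemma operator_series_commute (Y : F -> F) : bounded_op Y ->
  (forall i, T i \o Y = Y \o T i) -> X \o Y = Y \o X.
Proof.
move=> [Yl [M YM]] TY; apply/funext => x /=; apply/eqP; rewrite -subr_eq0; apply/eqP.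
apply: (tail_eq0 b_ub b_sup (c := complex.Re `|Y x| + `|M| * complex.Re `|x|)) => [|K].
  by rewrite addr_ge0 ?mulr_ge0 ?Re_norm_ge0.
have [_ Xn] := XP K; set P := partial_sum T K in Xn *.
have PY : P (Y x) = Y (P x).
  rewrite /P partial_sumE !fct_sumE (lin_sum Yl); apply: eq_bigr => i _.
  exact: (congr1 (@^~ x) (TY i)).
have -> : X (Y x) - Y (X x) = (X - P) (Y x) - Y ((X - P) x).
  by rewrite !fctE (linB Yl) PY opprB addrA subrK.
move: (S - _) Xn => s Xn; rewrite rmorphM rmorphD rmorphM /= -!norm_Re mulrDr.
apply: le_trans (ler_normB _ _) (lerD (Xn _) _).
apply: le_trans (YM _) _; apply: (@le_trans _ _ (`|M|%:C * `|(X - P) x|)).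
  by rewrite ler_wpM2r // lecR ler_norm.
by rewrite mulrCA ler_wpM2l // ler0c.
Qed.

End OperatorSeries.

Lemma opword_commute (R : realType) (d : nat) (q : R) (F : qFock d q)
    (A : 'I_d -> F -> F) (Y : F -> F) (w : word d) :
  (forall i, A i \o Y = Y \o A i) -> opword A w \o Y = Y \o opword A w.
Proof.
move=> AY; apply/funext => x /=; elim: w => //= j w ->.
exact: (congr1 (@^~ _) (AY j)).
Qed.

Lemma poly_alg_commute (R : realType) (d : nat) (q : R) (F : qFock d q)
    (A : 'I_d -> F -> F) (Y T : F -> F) : linear Y ->
  (forall i, A i \o Y = Y \o A i) -> poly_alg A T -> T \o Y = Y \o T.
Proof.
move=> Yl AY [Q _ <-]; apply/funext => x /=; rewrite !opevalE (lin_sum Yl).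
apply: eq_bigr => w _; rewrite (linZ Yl); congr (_ *: _).
exact: (congr1 (@^~ x) (opword_commute w AY)).
Qed.

Unset Implicit Arguments.

Theorem corollary4p7 (R : realType) (d : nat) (q : R) (hq : -1 < q < 1)
    (F : qFock d q)
    (l ls : 'I_d -> F -> F)
    (hls : left_creation ls)
    (hl : forall i, is_adjoint (ls i) (l i))
    (r : 'I_d -> F -> F)
    (hr : free_right_annihilation r)
    (rs : word d -> F -> F)
    (hrs : forall u, is_adjoint (opword r u) (rs u))
    (D : 'I_d -> unbounded_op F)
    (hD : normalized_dual_system (qgaussian l ls) D)
    (hDdom : forall i, udom (D i) = fock_alg F)
    (hD0 : forall i, D i (ebasis F [::]) = 0)
    (hDw : forall i w, (0 < size w)%N ->
       D i (ebasis F w) = dual_formula F i w) :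
  exists (xi : 'I_d -> F) (X : 'I_d -> F -> F) (T : 'I_d -> word d -> F -> F),
    conjugate_system (qgaussian l ls) xi /\
    forall i : 'I_d,
      [/\ adjoint_at (D i) (ebasis F [::]) (xi i),
          partial_sum (fun w => xi_coef q w *: rs (i :: w) (ebasis F w))
            @ totally --> xi i,
          forall w, poly_alg (qgaussian l ls) (T i w) /\
            T i w (ebasis F [::]) = rs (i :: w) (ebasis F w),
          (fun J =>
             opnorm (X i - partial_sum (fun w => xi_coef q w *: T i w) J))
            @ totally --> (0 : R) &
          [/\ X i (ebasis F [::]) = xi i,
              norm_closure (poly_alg (qgaussian l ls)) (X i) &
              vn_generated (qgaussian l ls) (X i)]].
Proof.
have q1 : `|q| < 1 by rewrite ltr_norml.
have [C C0 hC] := dual_series_weights hls hl hr hrs q1.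
set A := qgaussian l ls in hC *.
pose b (w : word d) := C * (2 * d.+1)%:R^-1 ^+ size w.
(* Taking the supremum itself, not just an upper bound, makes the tails [S - partial_sum b J]
   arbitrarily small. *)
pose S := sup (range (partial_sum b)).
have b_ge0 w : 0 <= b w by rewrite mulr_ge0 // exprn_ge0 // invr_ge0.
have hsup : has_sup (range (partial_sum b)).
  split; first by exists (partial_sum b fset0); exists fset0.
  exists (C * 2) => _ [J _ <-]; rewrite partial_sumE -mulr_sumr.
  by rewrite ler_wpM2l // word_weight_sum.
have b_ub J : partial_sum b J <= S by apply: (ub_le_sup hsup.2); exists J.
have b_sup eps : 0 < eps -> exists J, S - eps < partial_sum b J.
  by move=> eps0; have [_ [J _ <-] hJ] := sup_adherent eps0 hsup; exists J.
have hQ (p : 'I_d * word d) : exists Q, op_le (xi_coef q p.2 *: opeval A Q) (b p.2) /\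
    opeval A Q (ebasis F [::]) = rs (p.1 :: p.2) (ebasis F p.2).
  by have [Q] := hC p.1 p.2; exists Q.
have [Q QP] := choice hQ.
pose T i w := opeval A (Q (i, w)).
pose cT i w := xi_coef q w *: T i w.
have cTb i w : op_le (cT i w) (b w) by have [] := QP (i, w).
have Te i w : T i w (ebasis F [::]) = rs (i :: w) (ebasis F w) by have [] := QP (i, w).
have [X XP] := choice (fun i => operator_series b_ub b_sup (cTb i)).
pose xi i := X i (ebasis F [::]).
have xi_cvg i : partial_sum (fun w => xi_coef q w *: rs (i :: w) (ebasis F w))
    @ totally --> xi i.
  apply: (@cvg_partial_sum _ _ b S b_ge0 b_ub b_sup _ _ 1) => // J.
  have [_ /(_ (ebasis F [::]))] := XP i J; rewrite norm_vacuum !mulr1.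
  congr (`|_ - _| <= _); rewrite !partial_sumE fct_sumE.
  by apply: eq_bigr => w _; rewrite -Te.
have xi_adj i : adjoint_at (D i) (ebasis F [::]) (xi i).
  exact: dual_functional (hDdom i) (hD0 i) (hDw i) (xi_cvg i).
exists xi, X, T; split; first exact: conjugate_system_of_dual hD xi_adj.
move=> i.
have tail0 J : 0 <= S - partial_sum b J by rewrite subr_ge0.
have Xb : op_le (X i) S := operator_series_bounded (XP i).
have ps_poly J : poly_alg A (partial_sum (cT i) J).
  exists (\sum_(w <- J) xi_coef q w *: Q (i, w)) => //.
  rewrite partial_sumE (lin_sum (opeval_linear A)); apply: eq_bigr => w _.
  by rewrite (linZ (opeval_linear A)).
split => //.
- by move=> w; split=> //; exists (Q (i, w)).
- apply: (cvg_totally_tail b_ge0 b_sup) => J.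
  by rewrite opnorm_ge0 opnorm_le.
split => //.
- split; first exact: op_le_bounded Xb.
  move=> eps eps0; have [J hJ] := b_sup eps eps0.
  exists (partial_sum (cT i) J) => //.
  apply: le_lt_trans (opnorm_le (tail0 J) (XP i J)) _.
  by rewrite ltrBlDr -ltrBlDl.
(* As [M] is its own bicommutant, it suffices that [X i] commutes with each [Y] in the commutant of
   [M]; such [Y] commutes with the [A j], hence with every summand. *)
move=> M [_ MM] MA; rewrite -MM; split; first exact: op_le_bounded Xb.
move=> Y [Yb YM]; apply: (operator_series_commute b_ub b_sup (XP i)) => // w.
have [Yl _] := Yb; apply: (@poly_alg_commute _ _ _ _ A) => //.
  by move=> j; rewrite YM.
exists (xi_coef q w *: Q (i, w)) => //.
by rewrite (linZ (opeval_linear A)).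
Qed.
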